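(* Let $w\in\mathcal{W}_\beta$ be a weighting function with $\beta\geqslant1$, let $\widetilde\Delta$ be an approximation function satisfying $x^\varepsilon\leqslant\widetilde\Delta(x)\leqslant\exp(x^\zeta)$ for some $\varepsilon>0$ and $0<\zeta<\beta^{-1}$, and let $l\geqslant1$. Then the following statements hold. First, for almost every $\rho\in\mathbb{R}^d$ with $d\geqslant2$, there exist an observable $\bar\Psi\in\mathbb{R}^l_{\widetilde\Delta}(\mathbb{T}^d)$ and a dense set $\bar\Xi\subset\mathbb{T}$ with $0\in\bar\Xi$ such that for any $\theta=(0,\ldots,\widetilde\theta,\ldots,0)\in\mathbb{T}^d$ with $\widetilde\theta\in\bar\Xi$, the following inequality holds for infinitely many $N\in\mathbb{N}^+$: $$\mathbf{Error}_N^{\mathrm{dis}}(w,\bar\Psi,\rho,\theta)\geqslant\frac1{4\widetilde\Delta(N)}.$$ Similarly, for almost every $\rho\in\mathbb{R}^d$ with $d\geqslant3$, there exist an observable $\bar\Phi\in\mathbb{R}^l_{\widetilde\Delta}(\mathbb{T}^d)$ and a set $\bar\Theta\subset\mathbb{T}^2$ with $(0,0)\in\bar\Theta$ such that for any $\theta=(0,\ldots,0,\widetilde\theta_1,0,\ldots,0,\widetilde\theta_2,0,\ldots,0)\in\mathbb{T}^d$ with $\widetilde\theta=(\widetilde\theta_1,\widetilde\theta_2)\in\bar\Theta$, the following inequality holds for a sequence $T\to+\infty$: $$\mathbf{Error}_T^{\mathrm{con}}(w,\bar\Phi,\rho,\theta)\geqslant\frac1{4\widetilde\Delta(T)}.$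$
   Context: Notation: $d,l$ are positive integers; $\mathbb{T}^d=\mathbb{R}^d/\mathbb{Z}^d$; $\|\cdot\|_{\ell^\infty}$ is the maximum norm of the components of a vector; $\langle k,x\rangle=\sum_jk_jx_j$; ''almost every'' refers to Lebesgue measure. The coordinate position of $\widetilde\theta$ (respectively the positions of $\widetilde\theta_1,\widetilde\theta_2$) in $\theta$ is that of a suitable component (respectively suitable pair of components) of $\rho$, chosen together with the observable. Rotation: for $\rho\in\mathbb{R}^d$, $s\in\mathbb{R}$, $\theta\in\mathbb{T}^d$, put $\mathscr{T}^s_\rho(\theta)=\theta+s\rho\pmod{\mathbb{Z}^d}$. Approximation function: a continuous, strictly monotonically increasing function $\widetilde\Delta$ with $\widetilde\Delta(1)>0$ and $\widetilde\Delta(+\infty)=+\infty$. Weighting functions: $w$ is a non-negative $C^\infty$ function on $\mathbb{R}$ with $w(x)=0$ for $x\in\mathbb{R}\setminus[0,1]$ and $\int_0^1w(x)\,dx=1$. For $\beta\geqslant1$, $w\in\mathcal{W}_\beta$ means that in addition $D^jw(0)=D^jw(1)=0$ for all $j\geqslant0$, and there exist constants $\bar C,\lambda>0$ with $\|D^mw\|_{L^1(0,1)}\leqslant\bar C\lambda^mm^{m\beta}$ for all $m\in\mathbb{N}^+$. Space of observables: for an approximation function $\widetilde\Delta$, the space $\mathbb{R}^l_{\widetilde\Delta}(\mathbb{T}^d)$ consists of all smooth vector-valued observables $f:\mathbb{T}^d\to\mathbb{R}^l$ with Fourier series $f(\theta)=\sum_{k\in\mathbb{Z}^d}\widehat f(k)\exp(2\pi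 i\langle k,\theta\rangle)$, $\widehat f(k)=\int_{\mathbb{T}^d}f(x)\exp(-2\pi i\langle k,x\rangle)\,dx$, satisfying $$\|\widehat f(k)\|_{\ell^\infty}\leqslant\widetilde\Delta(\|k\|_{\ell^\infty})^{-1}\quad\text{for all }k\in\mathbb{Z}^d\setminus\{0\},\qquad\text{and}\qquad\sum_{k\in\mathbb{Z}^d\setminus\{0\}}\widetilde\Delta(\|k\|_{\ell^\infty})^{-1}<+\infty.$$ Errors of the weighted Birkhoff averages: with $A_N=\sum_{n=0}^{N-1}w(n/N)$, $$\mathbf{Error}_N^{\mathrm{dis}}(w,f,\rho,\theta)=\Big\|\frac1{A_N}\sum_{n=0}^{N-1}w(n/N)f(\mathscr{T}^n_\rho(\theta))-\int_{\mathbb{T}^d}f(x)\,dx\Big\|_{\ell^\infty},$$ $$\mathbf{Error}_T^{\mathrm{con}}(w,f,\rho,\theta)=\Big\|\frac1T\int_0^Tw(s/T)f(\mathscr{T}^s_\rho(\theta))\,ds-\int_{\mathbb{T}^d}f(x)\,dx\Big\|_{\ell^\infty}.$$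
   Formalization: Summability of 1/Δ̃(‖k‖) over nonzero k is assumed for the d in question (otherwise the space is empty), and ''smooth'' means C^r for every r with Σ‖k‖^r/Δ̃(‖k‖) finite, since for power-like Δ̃ the claim fails for C^∞ observables. *)

(* Defs.v *)
From HB Require Import structures.
From mathcomp Require Import all_boot all_order all_algebra.
From mathcomp Require Import all_classical all_reals all_analysis.
From mathcomp.analysis.showcase Require summability.
From mathcomp.real_closed Require Import complex.

Set Implicit Arguments.
Unset Strict Implicit.
Unset Printing Implicit Defensive.

Import Order.TTheory GRing.Theory Num.Theory.
Import numFieldNormedType.Exports.

Local Open Scope classical_set_scope.
Local Open Scope ring_scope.

(* Lebesgue measure on R^n is built on n-tuples, which carry the product Borel
   sigma-algebra in the library; points of R^n are otherwise row vectors, which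
   carry the topology and the maximum norm. *)
Section lebesgue_tuple.
Variable R : realType.
Local Notation RT := (measurableTypeR R).

Definition consp n (p : RT * n.-tuple RT) : n.+1.-tuple RT :=
  [tuple of p.1 :: p.2].

Lemma measurable_consp n : measurable_fun setT (@consp n).
Proof. exact: measurable_cons. Qed.

Section step.
Variables (n : nat) (m : {sigma_finite_measure set (n.-tuple RT) -> \bar R}).

Definition lebesgue_cons : set (n.+1.-tuple RT) -> \bar R :=
  pushforward (@lebesgue_measure R \x m)%E (@consp n).

Let lebesgue_cons0 : lebesgue_cons set0 = 0%E.
Proof. by rewrite /lebesgue_cons /pushforward preimage_set0 measure0. Qed.

Let lebesgue_cons_ge0 A : (0 <= lebesgue_cons A)%E.
Proof. by rewrite /lebesgue_cons /pushforward; exact: measure_ge0. Qed.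

Let lebesgue_cons_sigma_additive : semi_sigma_additive lebesgue_cons.
Proof.
have mc (A : set (n.+1.-tuple RT)) : measurable A -> measurable (@consp n @^-1` A).
  by move=> mA; rewrite -[_ @^-1` _]setTI; exact: measurable_consp.
move=> F mF tF mUF; rewrite /lebesgue_cons /pushforward preimage_bigcup.
apply: measure_semi_sigma_additive.
- by move=> k; exact: mc.
- apply/trivIsetP => /= i j _ _ ij; rewrite -preimage_setI.
  by move/trivIsetP : tF => /(_ _ _ _ _ ij) ->//; rewrite preimage_set0.
- by rewrite -preimage_bigcup; exact: mc.
Qed.

HB.instance Definition _ := isMeasure.Build _ _ _ lebesgue_cons
  lebesgue_cons0 lebesgue_cons_ge0 lebesgue_cons_sigma_additive.

Lemma lebesgue_cons_sigma_finite : sigma_finite setT lebesgue_cons.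
Proof.
have /sigma_finiteP[F [TF ndF Foo]] := sigma_finiteT (@lebesgue_measure R).
have /sigma_finiteP[G [TG ndG Goo]] := sigma_finiteT m.
pose dec (t : n.+1.-tuple RT) : RT * n.-tuple RT :=
  (thead t, [tuple of behead t]).
have consK : cancel (@consp n) dec.
  move=> [x t]; rewrite /dec /consp theadE /=; congr pair.
  exact/val_inj.
have mdec : measurable_fun setT dec.
  apply/measurable_fun_pairP; split; first exact: measurable_tnth.
  exact: measurable_behead.
exists (fun k => dec @^-1` (F k `*` G k)).
  apply/seteqP; split=> // t _.
  have [i _ Fi] : (\bigcup_i F i) (dec t).1 by rewrite -TF.
  have [j _ Gj] : (\bigcup_j G j) (dec t).2 by rewrite -TG.
  exists (maxn i j) => //; split.
    by move: Fi; exact/subsetPset/ndF/leq_maxl.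
  by move: Gj; exact/subsetPset/ndG/leq_maxr.
move=> k; have [mF Fk] := Foo k; have [mG Gk] := Goo k; split.
  by rewrite -[_ @^-1` _]setTI; apply: mdec => //; exact: measurableX.
rewrite /lebesgue_cons /pushforward -comp_preimage.
rewrite (_ : dec \o _ = id); last by apply/funext => p /=; rewrite consK.
by rewrite product_measure1E// lte_mul_pinfty// ge0_fin_numE.
Qed.

HB.instance Definition _ :=
  Measure_isSigmaFinite.Build _ _ _ lebesgue_cons lebesgue_cons_sigma_finite.

End step.

Fixpoint lebesgue_tuple n : {sigma_finite_measure set (n.-tuple RT) -> \bar R} :=
  match n with
  | 0 => \d_([tuple] : 0.-tuple RT)
  | n'.+1 => lebesgue_cons (lebesgue_tuple n')
  end.

Lemma lebesgue_tuple_box n (A : 'I_n -> set RT) :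
  (forall i, measurable (A i)) ->
  lebesgue_tuple n [set t | forall i, A i (tnth t i)] =
  (\prod_(i < n) lebesgue_measure (A i))%E.
Proof.
elim: n A => [|n IH] A mA /=.
  by rewrite big_ord0 diracE mem_set// => -[].
rewrite big_ord_recl /lebesgue_cons /pushforward.
rewrite (_ : _ @^-1` _ =
    A ord0 `*` [set t | forall i, A (lift ord0 i) (tnth t i)]); last first.
  apply/seteqP; split=> -[x t] /=.
    move=> H; split; first exact: (H ord0).
    by move=> i; have := H (lift ord0 i); rewrite tnthS.
  move=> [A0 H] i; case: (unliftP ord0 i) => [j ->|->]//.
  by rewrite tnthS; exact: H.
rewrite product_measure1E//; last first.
  rewrite (_ : [set _ | _] = \bigcap_(i in [set: 'I_n])
      ((@tnth n RT ^~ i) @^-1` A (lift ord0 i))); last first.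
    apply/seteqP; split=> t /=; first by move=> H i _; exact: H.
    by move=> H i; exact: H.
  apply: fin_bigcap_measurable => // i _.
  by rewrite -[_ @^-1` _]setTI; apply: measurable_tnth.
by congr (_ * _)%E; exact: (IH (fun i => A (lift ord0 i))).
Qed.

End lebesgue_tuple.

Section observables.
Variable R : realType.

Definition row_of_tuple d (t : d.-tuple (measurableTypeR R)) : 'rV[R]_d :=
  \row_i tnth t i.

Definition ae_rV d (P : 'rV[R]_d -> Prop) : Prop :=
  {ae lebesgue_tuple R d, forall t, P (row_of_tuple t)}.

(* Functions on the torus T^d are Z^d-periodic functions on R^d, and subsets of
   the torus are Z^d-invariant subsets of R^d. *)
Definition intvec d (m : 'rV[int]_d) : 'rV[R]_d := map_mx intr m.

Definition torus_fun d (V : Type) (f : 'rV[R]_d -> V) : Prop :=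
  forall x m, f (x + intvec m) = f x.

Definition torus_set1 (A : set R) : Prop :=
  forall x (m : int), A (x + m%:~R) <-> A x.

Definition torus_set2 (A : set (R * R)) : Prop :=
  forall x y (m n : int), A (x + m%:~R, y + n%:~R) <-> A (x, y).

Definition torus_integral d (f : 'rV[R]_d -> R) : R :=
  \int[lebesgue_tuple R d]_(t in [set t | forall i, tnth t i \in `[0, 1[])
    f (row_of_tuple t).

Definition torus_mean d l (f : 'rV[R]_d -> 'rV[R]_l) : 'rV[R]_l :=
  \row_j torus_integral (fun x => f x ord0 j).

Definition rotation d (rho : 'rV[R]_d) (s : R) (theta : 'rV[R]_d) : 'rV[R]_d :=
  theta + s *: rho.

Definition pairing d (k : 'rV[int]_d) (x : 'rV[R]_d) : R :=
  \sum_i (k ord0 i)%:~R * x ord0 i.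

Definition int_norm d (k : 'rV[int]_d) : nat := \max_i `|k ord0 i|%N.

(* exp(2 pi i t) *)
Definition cexp (t : R) : R[i] := Complex (cos (2 * pi * t)) (sin (2 * pi * t)).

Definition fourier_coef d (f : 'rV[R]_d -> R) (k : 'rV[int]_d) : R[i] :=
  Complex
    (torus_integral (fun x => f x * complex.Re (cexp (- pairing k x))))
    (torus_integral (fun x => f x * complex.Im (cexp (- pairing k x)))).

Definition fourier_coef_norm d l (f : 'rV[R]_d -> 'rV[R]_l) (k : 'rV[int]_d) : R :=
  \big[Num.max/0]_(j < l) Normc.normc (fourier_coef (fun x => f x ord0 j) k).

(* Convergence of an unordered series of complex numbers: the partial sums over
   finite sets of indices converge along the filter of finite sets. *)
Definition has_complex_sum (I : choiceType) (u : I -> R[i]) (s : R[i]) : Prop :=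
  (summability.partial_sum (fun k => complex.Re (u k)) @ summability.totally -->
     (complex.Re s : R)) /\
  (summability.partial_sum (fun k => complex.Im (u k)) @ summability.totally -->
     (complex.Im s : R)).

Definition approximation_function (Delta : R -> R) : Prop :=
  [/\ {within [set` `[1, +oo[], continuous Delta},
      {in `[1, +oo[ &, forall x y, x < y -> Delta x < Delta y},
      0 < Delta 1
    & Delta x @[x --> +oo] --> +oo].

Definition weighting_function (w : R -> R) : Prop :=
  [/\ forall x, 0 <= w x,
      forall m x, derivable (derive1n m w) x 1,
      forall x, x \notin `[0, 1] -> w x = 0
    & (\int[lebesgue_measure]_(x in `[0%R, 1%R]) (w x)%:E = 1)%E].

Definition weighting_class (beta : R) (w : R -> R) : Prop :=
  [/\ weighting_function w,
      forall j, derive1n j w 0 = 0 /\ derive1n j w 1 = 0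
    & exists C lambda : R, [/\ 0 < C, 0 < lambda &
        forall m, (0 < m)%N ->
          (\int[lebesgue_measure]_(x in `]0%R, 1%R[) `|derive1n m w x|%:E
             <= (C * lambda ^+ m * (m%:R `^ (m%:R * beta)))%:E)%E]].

(* [weight_summable Delta d 0] is the summability condition in the definition
   of the space of observables; larger [r] measure how many derivatives the
   decay rate 1 / Delta controls. *)
Definition weight_summable (Delta : R -> R) (d r : nat) : Prop :=
  (\esum_(k in [set k : 'rV[int]_d | k != 0%R])
     ((int_norm k)%:R ^+ r / Delta (int_norm k)%:R)%:E < +oo)%E.

Fixpoint class_C d (r : nat) (f : 'rV[R]_d -> R) : Prop :=
  match r with
  | 0 => continuous f
  | r'.+1 => continuous f /\
      forall i : 'I_d,
        (forall x, derivable f x (delta_mx ord0 i)) /\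
        class_C r' (fun x => 'D_(delta_mx ord0 i) f x)
  end.

(* The space of observables.  Its approximation functions range from powers
   x^e (finitely many derivatives) to exp (x^z), so "smooth" is graded by Delta:
   f is C^r for every r such that sum_(k <> 0) |k|^r / Delta |k| is finite.
   This is C^oo as soon as Delta dominates every power, and C^0 at least. *)
Definition observable_space (Delta : R -> R) d l (f : 'rV[R]_d -> 'rV[R]_l) : Prop :=
  [/\ torus_fun f,
      forall r, weight_summable Delta d r ->
        forall j, class_C r (fun x => f x ord0 j),
      forall theta j,
        has_complex_sum
          (fun k : 'rV[int]_d =>
             fourier_coef (fun x => f x ord0 j) k * cexp (pairing k theta))
          (Complex (f theta ord0 j) 0),
      forall k : 'rV[int]_d, k != 0 ->
        fourier_coef_norm f k <= (Delta (int_norm k)%:R)^-1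
    & weight_summable Delta d 0].

Definition weight_sum (w : R -> R) (N : nat) : R := \sum_(n < N) w (n%:R / N%:R).

(* The norm on row vectors is the maximum norm. *)
Definition error_dis d l (w : R -> R) (f : 'rV[R]_d -> 'rV[R]_l)
    (rho theta : 'rV[R]_d) (N : nat) : R :=
  `| (weight_sum w N)^-1 *:
       (\sum_(n < N) w (n%:R / N%:R) *: f (rotation rho n%:R theta))
     - torus_mean f |.

Definition error_con d l (w : R -> R) (f : 'rV[R]_d -> 'rV[R]_l)
    (rho theta : 'rV[R]_d) (T : R) : R :=
  `| T^-1 *:
       (\row_j \int[lebesgue_measure]_(s in `[0, T])
                 (w (s / T) * f (rotation rho s theta) ord0 j))
     - torus_mean f |.

End observables.

(* Main.v *)
Require Import Defs.
From mathcomp Require Import all_boot all_order all_algebra.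
From mathcomp Require Import all_classical all_reals all_analysis.
From mathcomp.analysis.showcase Require summability.
From mathcomp.real_closed Require complex.
From mathcomp Require finmap.
From mathcomp Require Import measurable_realfun ring lra zify.

Import Order.TTheory GRing.Theory Num.Theory.
Import numFieldNormedType.Exports.

Local Open Scope classical_set_scope.
Local Open Scope ring_scope.

(* The observable is [sum_n 2 / Delta |k_n| cos (2 pi <k_n, x>)] in every
   component, with frequencies [k_n] growing so fast that [Delta |k_n|] is
   lacunary, and the error is tested at time [|k_n|].  By Dirichlet's theorem
   [<k_n, rho>] can be taken within [delta / |k_n|] of an integer (of [0] for
   the flow, at the price of one more dimension), so the [n]-th mode hardly
   rotates up to that time and contributes at least [1 / Delta |k_n|].  The
   later modes are negligible by lacunarity.  An earlier mode has a fixed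
   nonresonant frequency, and repeated summation (or integration) by parts
   against the Gevrey weight shows that its average is [o (1 / Delta N)], so it
   is negligible as soon as [k_n] is chosen large enough.  Finally [k_n] is a
   multiple of [(n + 1)!], so the phase of the [n]-th mode at any given rational
   starting point is eventually trivial. *)

(** * Gevrey decay beats exp (N ^ zeta) *)

(** Nonresonance, which fails only on countably many null hyperplanes, is all that the proof asks of
    [rho]. It suffices because the [k_n] are chosen one after another: when [k_n] is sought, the
    earlier modes are finitely many and fixed, so the time after which they are negligible may
    depend on them in any way. The vector that Dirichlet's theorem returns is not under control: it
    may be short, and no divisibility is known. Both defects are repaired by multiplying it by an
    integer fixed beforehand. The loss is affordable because, for size at most K, the theorem gives
    a distance of order K^-2 (this is what the dimensions 2 and 3 provide), one power more than
    needed. The coefficient 2 of the cosine makes the Fourier coefficients at [k_n] and [- k_n]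
    equal to 1 / Delta |k_n|, the most that the space allows. *)

Lemma powR_large {R : realType} (delta c : R) : 0 < delta ->
  exists N0 : nat, forall N : nat, (N0 <= N)%N -> (1 <= N)%N /\ c <= N%:R `^ delta.
Proof.
move=> d0; pose b := Num.max 1 c.
have b1 : 1 <= b by rewrite /b le_max lexx.
exists (maxn 1 (Num.bound (b `^ delta^-1))) => N; rewrite geq_max => /andP[N1 Nb].
split => //; apply: (@le_trans _ _ b); first by rewrite /b le_max lexx orbT.
rewrite -[b]powRr1 ?(le_trans ler01 b1)// -[X in _ `^ X](mulVf (lt0r_neq0 d0)) powRrM.
apply: ge0_ler_powR; rewrite ?nnegrE ?powR_ge0 ?ler0n ?(ltW d0)//.
apply: (le_trans (ltW (archi_boundP (powR_ge0 _ _)))).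
by rewrite ler_nat.
Qed.

(** With p >= 3 / zeta, the inequality exp x >= (x / p) ^ p yields N ^ 3 up to a constant, and the
    spare power of N absorbs all constants. *)
Lemma expR_powR_large {R : realType} (zeta C : R) : 0 < zeta -> 0 <= C ->
  exists N0 : nat, forall N : nat, (N0 <= N)%N -> C * N%:R ^+ 2 <= expR (N%:R `^ zeta).
Proof.
move=> z0 C0.
pose p := (Num.bound (3 / zeta)).+1.
have pz : 3 <= zeta * p%:R.
  rewrite mulrC -ler_pdivrMr//; apply: ltW.
  apply: (lt_le_trans (archi_boundP _)); first by rewrite divr_ge0// ltW.
  by rewrite ler_nat.
have p0 : 0 < p%:R :> R by rewrite ltr0n.
exists (maxn 1 (Num.bound (C * p%:R ^+ p))) => N; rewrite geq_max => /andP[N1 Nb].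
have N1' : 1 <= N%:R :> R by rewrite ler1n.
have N0' : 0 <= N%:R :> R by rewrite ler0n.
set x := N%:R `^ zeta.
have x0 : 0 <= x by exact: powR_ge0.
have h : (x / p%:R) ^+ p <= expR x.
  have -> : expR x = expR (x / p%:R) ^+ p.
    by rewrite -expRM_natr divfK// lt0r_neq0.
  apply: lerXn2r; rewrite ?nnegrE ?expR_ge0 ?divr_ge0 ?(ltW p0)//.
  by apply: le_trans (expR_ge1Dx _); rewrite lerDr.
apply: le_trans h; rewrite expr_div_n ler_pdivlMr ?exprn_gt0//.
have xp : x ^+ p = N%:R `^ (zeta * p%:R).
  by rewrite powRrM powR_mulrn// powR_ge0.
have h3 : N%:R ^+ 3 <= x ^+ p.
  by rewrite xp -powR_mulrn//; apply: ler_powR.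
apply: le_trans h3; rewrite mulrAC [N%:R ^+ 3]exprS; apply: ler_wpM2r; first exact: exprn_ge0.
apply: (le_trans (ltW (archi_boundP _))); last by rewrite ler_nat.
by rewrite mulr_ge0// exprn_ge0// ltW.
Qed.

(* The right order is [m ~ N ^ zeta]: then [mu (m + 1) ^ beta / N] tends to [0]
   because [zeta beta < 1], and its [m]-th power beats [exp (N ^ zeta)]. *)
Lemma gevrey_decay {R : realType} (beta zeta C mu eps : R) :
  1 <= beta -> 0 < zeta -> zeta < beta^-1 -> 0 < C -> 0 < mu -> 0 < eps ->
  exists N0 : nat, forall N : nat, (N0 <= N)%N -> exists m : nat,
    C * (N + m)%:R * (mu / N%:R) ^+ m * (m.+1%:R `^ (m.+1%:R * beta))
      <= eps / expR (N%:R `^ zeta).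
Proof.
move=> b1 z0 zb C0 mu0 e0.
have b0 : 0 < beta by apply: lt_le_trans b1.
have d0 : 0 < 1 - zeta * beta.
  by rewrite subr_gt0 -(mulVf (lt0r_neq0 b0)) ltr_pM2r.
have zb1 : zeta <= 1 by apply: (le_trans (ltW zb)); rewrite invf_le1.
set delta := 1 - zeta * beta in d0.
pose K := mu * 2 `^ beta.
have K0 : 0 < K by rewrite mulr_gt0// powR_gt0.
have [N1 H1] := @powR_large R delta (K * expR 2) d0.
have C2 : 0 <= 2 * C / mu / eps by rewrite !divr_ge0 ?mulr_ge0 ?(ltW C0) ?(ltW mu0) ?(ltW e0).
have [N2 H2] := @expR_powR_large R zeta (2 * C / mu / eps) z0 C2.
exists (maxn N1 N2) => N; rewrite geq_max => /andP[NN1 NN2].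
have [N1' hd] := H1 _ NN1; have hC := H2 _ NN2.
have Nr1 : 1 <= N%:R :> R by rewrite ler1n.
have Nr0 : 0 < N%:R :> R by apply: lt_le_trans Nr1.
set x := N%:R `^ zeta in hC *.
have x1 : 1 <= x by rewrite -(powRr0 N%:R); apply: ler_powR => //; exact: ltW.
have x0 : 0 <= x by apply: le_trans x1.
exists (Num.truncn x).
set m := Num.truncn x.
have /andP[mx xm] : m%:R <= x < m.+1%:R by exact: truncn_itv.
have xN : x <= N%:R by rewrite -[leRHS]powRr1 ?(ltW Nr0)//; apply: ler_powR.
have mN : (N + m)%:R <= 2 * N%:R :> R.
  by rewrite natrD mulr_natl mulr2n lerD2l; exact: le_trans xN.
have m2x : m.+1%:R <= 2 * x by rewrite -natr1; lra.
pose r := mu / N%:R * m.+1%:R `^ beta.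
have r0 : 0 <= r by rewrite mulr_ge0 ?powR_ge0// divr_ge0 ?ltW.
(* The exponent 2 makes [r ^+ m.+1] at most exp (- 2 x): one factor exp (- x) is the target, the
   other pays for the prefactor of order N ^ 2. *)
have rle : r <= expR (- 2).
  have h1 : m.+1%:R `^ beta <= 2 `^ beta * N%:R `^ (zeta * beta).
    rewrite powRrM -powRM//; apply: ge0_ler_powR; rewrite ?nnegrE ?(ltW b0)//.
  apply: (@le_trans _ _ (K / N%:R `^ delta)).
    rewrite /r /K.
    have -> : (N%:R `^ delta)^-1 = N%:R^-1 * N%:R `^ (zeta * beta).
      rewrite /delta powRB ?lt0r_neq0 ?implybT// powRr1 ?(ltW Nr0)//.
      by rewrite invf_div mulrC.
    rewrite mulrACA. apply: ler_wpM2l => //.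
    by rewrite divr_ge0 ?ltW.
  rewrite ler_pdivrMr ?powR_gt0// mulrC expRN ler_pdivlMr ?expR_gt0//.
have rm : (mu / N%:R) ^+ m * (m.+1%:R `^ (m.+1%:R * beta)) = N%:R / mu * r ^+ m.+1.
  rewrite /r [(mu / _ * _) ^+ m.+1]exprMn [m.+1%:R * beta]mulrC powRrM powR_mulrn ?powR_ge0//.
  have : mu / N%:R != 0 by rewrite lt0r_neq0// divr_gt0.
  rewrite -[N%:R / mu]invf_div; move: (mu / N%:R) => q q0.
  by rewrite (exprS q m) !mulrA mulVf ?mul1r.
rewrite -mulrA rm.
have rx : r ^+ m.+1 <= expR (- x) * expR (- x).
  apply: (@le_trans _ _ (expR (-2) ^+ m.+1)).
    by apply: lerXn2r; rewrite ?nnegrE ?expR_ge0.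
  by rewrite -expRM_natr -expRD ler_expR -opprD mulNr lerN2 mulr_natl [_ *+ 2]mulr2n lerD// ltW.
have -> : eps / expR x = eps * expR x * (expR (-x) * expR (-x)).
  by rewrite -mulrA [expR x * _]mulrA expRxMexpNx_1 mul1r expRN.
apply: (@le_trans _ _ (C * (2 * N%:R) * (N%:R / mu * (expR (- x) * expR (- x))))).
  apply: ler_pM => //.
  - by rewrite mulr_ge0 ?ler0n ?(ltW C0).
  - by rewrite mulr_ge0 ?exprn_ge0// divr_ge0 ?ler0n ?(ltW mu0).
  - by rewrite ler_pM2l.
  - by rewrite ler_pM2l// divr_gt0.
rewrite [leLHS]mulrA; apply: ler_wpM2r; first by rewrite mulr_ge0 ?expR_ge0.
have -> : C * (2 * N%:R) * (N%:R / mu) = eps * (2 * C / mu / eps * N%:R ^+ 2).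
  rewrite [RHS]mulrC [RHS]mulrAC divfK ?lt0r_neq0// expr2 [N%:R / mu]mulrC.
  by rewrite [2 * C]mulrC -!mulrA; congr (_ * (_ * _)); rewrite mulrCA.
by rewrite ler_pM2l.
Qed.

(** * Weighted averages of a single mode *)

Definition backdiff {R : realType} (h : R) (g : R -> R) (x : R) : R := g x - g (x - h).

Lemma is_derive_iter_backdiff {R : realType} (h : R) (m : nat) (g : R -> R) :
  (forall x : R, derivable g x 1) ->
  forall x : R, is_derive x 1 (iter m (backdiff h) g) (iter m (backdiff h) (derive1 g) x).
Proof.
move=> dg; elim: m => [|m IH] x /=.
  by rewrite derive1E; apply/derivableP; exact: dg.
have d2 : is_derive x 1 (fun y => iter m (backdiff h) g (y - h))
    (iter m (backdiff h) (derive1 g) (x - h)).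
  have d1 : is_derive x 1 (fun y : R => y - h) 1.
    by apply: is_derive_eq; rewrite subr0.
  have := @is_derive1_comp R _ _ x _ _ (IH (x - h)) d1.
  by rewrite mulr1.
exact: (is_deriveB (IH x) d2).
Qed.

(** Differences commute with the derivative, so the mean value theorem on the outermost difference
    trades it for a factor h and replaces g by g'. Hence the induction is over all g. *)
Lemma iter_backdiff_bound {R : realType} (h B : R) (m : nat) (g : R -> R) :
  0 <= h -> (forall i (x : R), derivable (derive1n i g) x 1) ->
  (forall x, `|derive1n m g x| <= B) ->
  forall x, `|iter m (backdiff h) g x| <= h ^+ m * B.
Proof.
move=> h0; elim: m g => [|m IH] g dg gB x /=; first by rewrite expr0 mul1r; exact: gB.
have dG y := @is_derive_iter_backdiff R h m g (dg 0%N) y.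
have cG : continuous (iter m (backdiff h) g).
  by move=> y; apply: differentiable_continuous; apply/derivable1_diffP; case: (dG y).
have xh : x - h <= x by rewrite gerBl.
have [c _] := MVT_segment xh (fun y _ => dG y) (continuous_subspaceT cG).
rewrite /backdiff => ->.
rewrite normrM opprB addrC subrK (ger0_norm h0) exprSr mulrAC.
apply: ler_wpM2r => //; apply: IH => [i y|y].
- by rewrite /derive1n -iterSr; exact: (dg i.+1).
- by rewrite /derive1n -iterSr; exact: gB.
Qed.

(** Backward differences spread the support to the right only: the value at [- h] stays 0, and each
    summation by parts lengthens the sum by a single term. *)
Lemma iter_backdiff_supp {R : realType} (h : R) (m : nat) (g : R -> R) : 0 <= h ->
  (forall x, x < 0 \/ 1 <= x -> g x = 0) ->
  forall x, x < 0 \/ 1 + m%:R * h <= x -> iter m (backdiff h) g x = 0.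
Proof.
move=> h0 g0; elim: m => [|m IH] x /=; first by rewrite mul0r addr0; exact: g0.
rewrite /backdiff -[m.+1%:R]natr1 mulrDl mul1r addrA => H.
by rewrite !IH ?subr0//; case: H => H; [left|right|left|right]; lra.
Qed.

(* Summation by parts against [cos (2 a n + phi)], the difference of
   [sin (2 a n + phi - a) / (2 sin a)]. *)
Lemma cos_sum_by_parts {R : realType} (g : R -> R) (h a phi : R) (L : nat) :
  g (- h) = 0 -> g (L%:R * h) = 0 ->
  2 * sin a * (\sum_(n < L) g (n%:R * h) * cos (2 * a * n%:R + phi)) =
  - \sum_(n < L.+1) backdiff h g (n%:R * h) * cos (2 * a * n%:R + (phi - a - pi / 2)).
Proof.
move=> gN gL.
pose s n := sin (2 * a * n%:R + phi - a).
have sE n : 2 * sin a * cos (2 * a * n%:R + phi) = s n.+1 - s n.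
  rewrite /s -[n.+1%:R]natr1.
  have -> : 2 * a * (n%:R + 1) + phi - a = (2 * a * n%:R + phi) + a by ring.
  by rewrite sinD sinB; ring.
have -> : 2 * sin a * (\sum_(n < L) g (n%:R * h) * cos (2 * a * n%:R + phi)) =
    \sum_(n < L) g (n%:R * h) * s n.+1 - \sum_(n < L.+1) g (n%:R * h) * s n.
  rewrite big_ord_recr/= gL mul0r addr0 -sumrB mulr_sumr.
  by apply: eq_bigr => n _; rewrite mulrCA sE mulrBr.
rewrite [X in _ = - X](_ : _ = \sum_(n < L.+1) g (n%:R * h) * s n -
    \sum_(n < L.+1) g (n%:R * h - h) * s n); last first.
  rewrite -sumrB; apply: eq_bigr => n _.
  by rewrite !addrA cosBpihalf -mulrBl.
rewrite opprB [X in _ = X - _]big_ord_recl /= mul0r sub0r gN mul0r add0r.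
congr (_ - _); apply: eq_bigr => n _.
congr (g _ * _).
by rewrite /bump/= add1n -[n.+1%:R]natr1; ring.
Qed.

(** Each summation by parts gains 1 / |2 sin a| and returns a cosine sum with the phase shifted by a
    + pi / 2, so it can be repeated m times. Each of the N + m terms left is an m-th difference with
    step 1 / N. *)
Lemma discrete_decay {R : realType} (w : R -> R) (B a phi : R) (m N : nat) :
  (forall i (x : R), derivable (derive1n i w) x 1) ->
  (forall x, x < 0 \/ 1 <= x -> w x = 0) ->
  (forall x, `|derive1n m w x| <= B) -> sin a != 0 -> (0 < N)%N ->
  `|\sum_(n < N) w (n%:R / N%:R) * cos (2 * a * n%:R + phi)| <=
    (N + m)%:R * (`|2 * sin a|^-1 / N%:R) ^+ m * B.
Proof.
move=> dw w0 wB sa N0.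
pose h : R := N%:R^-1.
have h0 : 0 < h by rewrite invr_gt0 ltr0n.
have Nh : N%:R * h = 1 by rewrite divff// pnatr_eq0 -lt0n.
have c0 : 0 < `|2 * sin a| by rewrite normr_gt0 mulf_neq0.
have key : forall k ph, `|\sum_(n < N) w (n%:R / N%:R) * cos (2 * a * n%:R + ph)| =
    `|2 * sin a|^-1 ^+ k * `|\sum_(n < N + k) iter k (backdiff h) w (n%:R * h) *
        cos (2 * a * n%:R + (ph - k%:R * (a + pi / 2)))|.
  move=> k ph; elim: k => [|k ->].
    by rewrite expr0 mul1r addn0 mul0r subr0.
  rewrite exprSr -mulrA; congr (_ * _).
  apply: (mulfI (lt0r_neq0 c0)); rewrite mulrA divff ?lt0r_neq0// mul1r -normrM.
  have g1 : iter k (backdiff h) w (- h) = 0.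
    by apply: (iter_backdiff_supp _ _ _ (ltW h0) w0); left; rewrite oppr_lt0.
  have g2 : iter k (backdiff h) w ((N + k)%:R * h) = 0.
    by apply: (iter_backdiff_supp _ _ _ (ltW h0) w0); right; rewrite natrD mulrDl Nh.
  rewrite (cos_sum_by_parts _ _ _ _ _ g1 g2).
  rewrite normrN addnS; congr (`| _ |); apply: eq_bigr => n _.
  by congr (_ * cos (_ + _)); rewrite -[k.+1%:R]natr1; ring.
rewrite (key m phi) exprMn mulrA [(N + m)%:R * _]mulrC -!mulrA.
rewrite ler_pM2l ?exprn_gt0 ?invr_gt0//.
apply: (le_trans (ler_norm_sum _ _ _)).
apply: (@le_trans _ _ (\sum_(n < N + m) h ^+ m * B)).
  apply: ler_sum => n _; rewrite normrM -[leRHS]mulr1.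
  apply: ler_pM => //; last by rewrite ler_norml cos_geN1 cos_le1.
  by apply: iter_backdiff_bound => //; exact: ltW.
by rewrite sumr_const card_ord mulr_natl.
Qed.

Lemma derivable_continuous {R : realType} (f : R -> R) :
  (forall x : R, derivable f x 1) -> continuous f.
Proof.
by move=> df x; apply: differentiable_continuous; apply/derivable1_diffP; exact: df.
Qed.

Lemma derivable_LRcontinuous {R : realType} (f : R -> R) (a b : R) :
  (forall x : R, derivable f x 1) -> derivable_oo_LRcontinuous f a b.
Proof.
move=> df; split => [x _||]; first exact: df.
- by apply: cvg_at_right_filter; exact: derivable_continuous.
- by apply: cvg_at_left_filter; exact: derivable_continuous.
Qed.

Lemma continuous_integrable_itv {R : realType} (f : R -> R) (a b : R) :
  continuous f -> (@lebesgue_measure R).-integrable `[a, b] (EFin \o f).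
Proof.
move=> cf; apply: continuous_compact_integrable; first exact: segment_compact.
exact: continuous_subspaceT.
Qed.

(** Strictly outside [0, 1] the function is locally zero, which passes to derivatives; the point 1
    itself comes from the flatness condition of the class. *)
Lemma weight_supp {R : realType} (beta : R) (w : R -> R) (m : nat) (x : R) :
  weighting_class beta w -> x < 0 \/ 1 <= x -> derive1n m w x = 0.
Proof.
move=> [[_ dw w0 _] w01 _] H.
have w0' y : y < 0 \/ 1 < y -> w y = 0.
  by move=> H'; apply: w0; rewrite in_itv/= negb_and -!ltNge; apply/orP.
suff h y : y < 0 \/ 1 < y -> derive1n m w y = 0.
  case: H => [x0|]; first by apply: h; left.
  rewrite le_eqVlt => /predU1P[<-|x1]; first by have [] := w01 m.
  by apply: h; right.
elim: m y => [|m IH] y; first exact: w0'.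
move=> Hy; rewrite derive1nS derive1E.
rewrite -[RHS](@derive_cst R R R 0 y 1); apply: near_eq_derive.
case: Hy => Hy.
  near=> z; apply: IH; left; near: z; exact: lt_nbhsl.
near=> z; apply: IH; right; near: z; exact: lt_nbhsr.
Unshelve. all: by end_near. Qed.

(** The m-th derivative vanishes at 0, so its supremum is at most the L^1 norm of the next one. This
    is the origin of the index m + 1 in [gevrey_decay]. *)
Lemma weight_derive_bound {R : realType} (beta : R) (w : R -> R) :
  weighting_class beta w ->
  exists C lambda : R, [/\ 0 < C, 0 < lambda &
    forall m x, `|derive1n m w x| <=
      C * lambda ^+ m.+1 * (m.+1%:R `^ (m.+1%:R * beta))].
Proof.
move=> hw; have [[_ dw _ _] w01 [C [lambda [C0 l0 H]]]] := hw.
exists C, lambda; split => // m x.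
have [x01|x01] := boolP ((0 < x) && (x < 1)); last first.
  have -> : derive1n m w x = 0.
    move: x01; rewrite negb_and -!leNgt => /orP[|x1].
      rewrite le_eqVlt => /predU1P[->|x0]; first by have [] := w01 m.
      by apply: (weight_supp _ _ _ _ hw); left.
    by apply: (weight_supp _ _ _ _ hw); right.
  by rewrite normr0 !mulr_ge0 ?powR_ge0 ?exprn_ge0 ?(ltW C0) ?(ltW l0).
have /andP[x0 x1] := x01.
have cw i : continuous (derive1n i w) by exact: derivable_continuous.
have ftc : (\int[lebesgue_measure]_(y in `[0%R, x]) ((derive1n m.+1 w y)%:E) =
    (derive1n m w x)%:E)%E.
  rewrite (@continuous_FTC2 R (derive1n m.+1 w) (derive1n m w) 0 x)//.
  - by have [-> _] := w01 m; rewrite sube0.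
  - exact: continuous_subspaceT.
  - exact: derivable_LRcontinuous.
have mw : measurable_fun setT (derive1n m.+1 w : measurableTypeR R -> measurableTypeR R).
  exact: continuous_measurable_fun.
rewrite -lee_fin; apply: le_trans (H m.+1 isT).
rewrite -[X in (X <= _)%E]abse_EFin -ftc.
apply: (le_trans (le_abse_integral _ _ _)) => //.
  by apply/measurable_EFinP; exact: measurable_funTS.
rewrite -(@integral_itv_bndoo R 0 1 _ true false); last first.
  by apply/measurable_EFinP; apply: measurable_funTS; exact: measurableT_comp.
apply: ge0_subset_integral => //.
  by apply/measurable_EFinP; apply: measurable_funTS; exact: measurableT_comp.
by apply: subset_itvl; rewrite bnd_simp ltW.
Qed.

(** Boundary terms vanish by flatness at 0 and 1. Each step gains 1 / |a|, and the sine is read as a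
    cosine with phase shifted by pi / 2, which allows iteration. *)
Lemma integral_cos_by_parts {R : realType} (w : R -> R) (a B : R) (m : nat) :
  (forall i (x : R), derivable (derive1n i w) x 1) ->
  (forall i, derive1n i w 0 = 0 /\ derive1n i w 1 = 0) ->
  (forall x, `|derive1n m w x| <= B) -> a != 0 ->
  forall phi, `|\int[lebesgue_measure]_(x in `[0, 1]) (w x * cos (a * x + phi))| <=
    `|a|^-1 ^+ m * B.
Proof.
move=> dw w01 wB a0.
have dl phi (x : R) : is_derive x 1 (fun y : R => a * y + phi) a.
  apply: is_derive_eq.
  by rewrite addr0; exact: mulr1.
have ds phi (x : R) : is_derive x 1 (fun y => sin (a * y + phi)) (a * cos (a * x + phi)).
  rewrite mulrC; have := @is_derive1_comp R sin (fun y => a * y + phi) x _ _ _ (dl phi x).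
  by apply.
have cc phi : continuous (fun y => cos (a * y + phi)).
  move=> x; apply: continuous_comp; last exact: continuous_cos.
  by apply: (@derivable_continuous R (fun y => a * y + phi)) => y; case: (dl phi y).
have cw i : continuous (derive1n i w) by exact: derivable_continuous.
have key k phi : `|\int[lebesgue_measure]_(x in `[0, 1]) (w x * cos (a * x + phi))| =
    `|a|^-1 ^+ k * `|\int[lebesgue_measure]_(x in `[0, 1])
      (derive1n k w x * cos (a * x + (phi - k%:R * (pi / 2))))|.
  elim: k => [|k ->]; first by rewrite expr0 mul1r mul0r subr0.
  rewrite exprSr -mulrA; congr (_ * _).
  have an0 : `|a| != 0 by rewrite normr_eq0.
  apply: (mulfI an0); rewrite [RHS]mulrA divff// mul1r -normrM.
  set ps := phi - k%:R * (pi / 2).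
  rewrite -RintegralZl//; last first.
    apply: continuous_integrable_itv => x; apply: continuousM; [exact: cw|exact: cc].
  under eq_Rintegral do rewrite mulrCA.
  rewrite (@Rintegration_by_parts R (derive1n k w) (fun x => sin (a * x + ps))
    (derive1n k.+1 w) (fun x => a * cos (a * x + ps)) 0 1)//.
  - have [-> ->] := w01 k; rewrite !mul0r subrr sub0r normrN.
    congr (`| _ |); apply: eq_Rintegral => x _; rewrite -cosBpihalf.
    by congr (_ * cos _); rewrite /ps -[k.+1%:R]natr1; ring.
  - exact: continuous_subspaceT.
  - exact: derivable_LRcontinuous.
  - apply: continuous_subspaceT => x; apply: continuousM; [exact: cst_continuous|exact: cc].
  - by apply: derivable_LRcontinuous => x; case: (ds ps x).
  - by move=> x _; rewrite derive1E; case: (ds ps x).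
move=> phi; rewrite (key m phi); apply: ler_wpM2l; first by rewrite exprn_ge0// invr_ge0.
pose f x := derive1n m w x * cos (a * x + (phi - m%:R * (pi / 2))).
have cf : continuous f.
  by move=> x; apply: continuousM; [exact: cw|exact: cc].
apply: (le_trans (le_normr_Rintegral _ (continuous_integrable_itv _ _ _ cf))) => //.
apply: (@le_trans _ _ (\int[@lebesgue_measure R]_(x in `[0, 1]) B)).
  apply: le_Rintegral => //.
  - by apply: continuous_integrable_itv => x; apply: continuous_comp;
      [exact: cf|exact: norm_continuous].
  - by apply: continuous_integrable_itv => x; exact: cst_continuous.
  - move=> x _; rewrite /f normrM -[leRHS]mulr1.
    by apply: ler_pM => //; rewrite ler_norml cos_geN1 cos_le1.
by rewrite Rintegral_cst//= lebesgue_measure_itv/= lte_fin ltr01 -EFinD/= subr0 mulr1.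
Qed.

Lemma Rintegral_rescale {R : realType} (f : R -> R) (T : R) : 0 < T -> continuous f ->
  T^-1 * \int[lebesgue_measure]_(s in `[0, T]) f s =
  \int[lebesgue_measure]_(x in `[0, 1]) f (T * x).
Proof.
move=> T0 cf.
have dl (x : R) : is_derive x 1 (fun y : R => T * y) T.
  by apply: is_derive_eq; exact: mulr1.
have dE : (fun y : R => T * y)^`()%classic = cst T.
  by apply/funext => x; rewrite derive1E; case: (dl x).
have Tn : T != 0 by rewrite lt0r_neq0.
have cT : continuous (fun x => f (T * x)).
  move=> x; apply: continuous_comp; last exact: cf.
  by apply: (@derivable_continuous R (fun y => T * y)) => y; case: (dl y).
have -> : \int[lebesgue_measure]_(s in `[0, T]) f s =
    \int[lebesgue_measure]_(x in `[0, 1]) (T * f (T * x)).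
  have := @integration_by_substitution_increasing R (fun y => T * y) f 0 1 ler01.
  rewrite dE mulr0 mulr1 /Rintegral => ->.
  - by congr fine; apply: eq_integral => x _; congr EFin; exact: mulrC.
  - by move=> x y _ _ xy; rewrite ltr_pM2l.
  - by move=> x _; exact: cst_continuous.
  - exact: is_cvg_cst.
  - exact: is_cvg_cst.
  - by apply: derivable_LRcontinuous => x; case: (dl x).
  - exact: continuous_subspaceT.
by rewrite RintegralZl ?mulKf//; exact: continuous_integrable_itv.
Qed.

Lemma cos_addint {R : realType} (x : R) (z : int) : cos (x + 2 * pi * z%:~R) = cos x.
Proof.
have T n y : cos (y + 2 * pi * n%:R) = cos y :> R.
  by rewrite -[RHS](periodicn (@cosD2pi R) n) mulr_natr mulr_natl.
case: z => n; first exact: T.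
by rewrite NegzE mulrNz mulrN -(T n.+1) subrK.
Qed.

Lemma sin_pi_neq0 {R : realType} (a : R) : (forall z : int, a != z%:~R) -> sin (pi * a) != 0.
Proof.
move=> az; apply/negP => /eqP s0.
(* An integer shift of [a] is only a half period of sin (pi a) but a full period of cos (2 pi a);
   passing through the latter avoids tracking signs. *)
have c2 (x : R) : cos (2 * x) = 1 - 2 * sin x ^+ 2.
  by rewrite mulr_natl mulr2n cosD -!expr2 cos2sin2; ring.
pose r := a - (Num.floor a)%:~R.
have /andP[fl fu] := floor_itv a.
have r0 : 0 < r by rewrite subr_gt0 lt_neqAle fl eq_sym az.
have r1 : r < 1 by rewrite ltrBlDl -[ltRHS]/(_%:~R + 1%:~R) -intrD.
have : cos (2 * (pi * a)) = cos (2 * (pi * r)).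
  rewrite -(cos_addint (2 * (pi * r)) (Num.floor a)); congr cos.
  by rewrite /r; ring.
rewrite !c2 s0 expr0n/= mulr0 subr0 => /esym/eqP.
rewrite subr_eq addrC -subr_eq subrr eq_sym mulf_eq0 pnatr_eq0/= sqrf_eq0.
have /lt0r_neq0/negPf -> // : 0 < sin (pi * r).
apply: sin_gt0_pi; rewrite mulr_gt0 ?pi_gt0//=.
by rewrite -[ltRHS]mulr1 ltr_pM2l ?pi_gt0.
Qed.

Lemma cos_ge_half {R : realType} : exists2 d : R, 0 < d & forall x, `|x| <= d -> 1 / 2 <= cos x.
Proof.
have /cvgrPdist_lt /(_ (1 / 2)) : cos x @[x --> (0 : R)] --> cos (0 : R) by exact: continuous_cos.
have h0 : 0 < 1 / 2 :> R by [].
move=> /(_ h0) /nbhs_ballP[e /= e0 H].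
exists (e / 2); first by rewrite divr_gt0.
move=> x xe; have : `|cos 0 - cos x| < 1 / 2.
  apply: H; rewrite /ball/= sub0r normrN; apply: le_lt_trans xe _.
  by rewrite ltr_pdivrMr// ltr_pMr// ltr1n.
by rewrite cos0 ltr_norml => /andP[_]; lra.
Qed.

Lemma weight_pos {R : realType} (beta : R) (w : R -> R) :
  weighting_class beta w -> exists x, [/\ 0 < x, x < 1 & 0 < w x].
Proof.
move=> hw; have [[w0 dw _ w1] _ _] := hw.
apply: contrapT => H.
have wz x : w x = 0.
  have [x0|x0] := leP x 0.
    move: x0; rewrite le_eqVlt => /predU1P[->|x0].
      by have [_ /(_ 0%N)[]] := hw.
    by apply: (weight_supp _ _ 0 _ hw); left.
  have [x1|x1] := leP 1 x; first by apply: (weight_supp _ _ 0 _ hw); right.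
  apply/eqP; rewrite eq_le w0 andbT leNgt; apply/negP => wx.
  by apply: H; exists x.
move: w1; under eq_integral do rewrite wz.
by rewrite integral0 => /eqP; rewrite eqe eq_sym oner_eq0.
Qed.

(** A single sample close to a point where w is positive gives a bound independent of N. A constant
    is enough, since the decay of the sums is faster than any power of N. *)
Lemma weight_sum_ge {R : realType} (beta : R) (w : R -> R) : weighting_class beta w ->
  exists2 c : R, 0 < c & exists N0 : nat, forall N, (N0 <= N)%N -> (0 < N)%N /\ c <= weight_sum w N.
Proof.
move=> hw; have [x0 [x00 x01 wx0]] := weight_pos _ _ hw.
have [[w0 dw _ _] _ _] := hw.
have cw : continuous w := derivable_continuous _ (dw 0%N).
have /cvgrPdist_lt /(_ (w x0 / 2)) : w x @[x --> x0] --> w x0 by exact: cw.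
have h2 : 0 < w x0 / 2 by rewrite divr_gt0.
move=> /(_ h2) /nbhs_ballP[e /= e0 H].
exists (w x0 / 2) => //.
exists (maxn 1 (Num.bound (e^-1))) => N; rewrite geq_max => /andP[N1 Nb]; split => //.
have Nr0 : 0 < N%:R :> R by rewrite ltr0n.
have eN : e^-1 < N%:R.
  apply: (lt_le_trans (archi_boundP _)); first by rewrite invr_ge0 ltW.
  by rewrite ler_nat.
have xN0 : 0 <= x0 * N%:R by rewrite mulr_ge0// ltW.
have /andP[nl nu] := truncn_itv xN0; set n := Num.truncn _ in nl nu.
have nN : (n < N)%N.
  rewrite -(ltr_nat R); apply: le_lt_trans nl _.
  by rewrite -[ltRHS]mul1r ltr_pM2r.
have dn : `|x0 - n%:R / N%:R| < e.
  have -> : x0 - n%:R / N%:R = (x0 * N%:R - n%:R) / N%:R.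
    by rewrite mulrBl mulfK// lt0r_neq0.
  rewrite normrM ger0_norm ?subr_ge0// ger0_norm ?invr_ge0 ?ler0n//.
  rewrite ltr_pdivrMr//; apply: (@lt_trans _ _ 1).
    by rewrite ltrBlDl; move: nu; rewrite -natr1 addrC.
  by rewrite -[ltLHS](divff (lt0r_neq0 e0)) ltr_pM2l.
rewrite /weight_sum (bigD1 (Ordinal nN))//=.
apply: (@le_trans _ _ (w (n%:R / N%:R))); last by rewrite lerDl sumr_ge0.
have := H _ dn; rewrite ltr_norml => /andP[_]; rewrite /=; lra.
Qed.

Definition avg_dis {R : realType} (w : R -> R) (N : nat) (a phi : R) : R :=
  (weight_sum w N)^-1 * \sum_(n < N) w (n%:R / N%:R) * cos (phi + 2 * pi * (a * n%:R)).

Definition avg_con {R : realType} (w : R -> R) (T a phi : R) : R :=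
  T^-1 * \int[lebesgue_measure]_(s in `[0, T]) (w (s / T) * cos (phi + 2 * pi * (a * s))).

Section averages.
Context {R : realType}.
Variables (beta : R) (w Delta : R -> R).
Hypothesis hw : weighting_class beta w.

Let w_ge0 x : 0 <= w x. Proof. by have [[]] := hw. Qed.

Lemma avg_dis_le1 N a phi : `|avg_dis w N a phi| <= 1.
Proof.
rewrite /avg_dis; set A := weight_sum w N.
have A0 : 0 <= A by apply: sumr_ge0.
(* If all sampled weights vanish, the inverse of 0 is 0 and so is the average. *)
have [->|An] := eqVneq A 0; first by rewrite invr0 mul0r normr0.
have Ap : 0 < A by rewrite lt_neqAle eq_sym An.
rewrite normrM (ger0_norm (_ : 0 <= A^-1)) ?invr_ge0// mulrC ler_pdivrMr// mul1r.
apply: le_trans (ler_norm_sum _ _ _) _; apply: ler_sum => n _.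
rewrite normrM (ger0_norm (w_ge0 _)) -[leRHS]mulr1 ler_wpM2l//.
by rewrite ler_norml cos_geN1 cos_le1.
Qed.

(** At integer times the multiples of [z] drop out of the phase. What remains stays below [d] up to
    time N, so every cosine in the average is at least 1 / 2. *)
Lemma avg_dis_ge d : (forall x : R, `|x| <= d -> 1 / 2 <= cos x) ->
  exists N0 : nat, forall N a (z z' : int), (N0 <= N)%N ->
    2 * pi * (`|a - z%:~R| * N%:R) <= d -> 1 / 2 <= avg_dis w N a (2 * pi * z'%:~R).
Proof.
move=> hd; have [c c0 [N0 H]] := weight_sum_ge _ _ hw.
exists N0 => N a z z' /H[N1 cA] hz.
have Ap : 0 < weight_sum w N by apply: lt_le_trans cA.
rewrite /avg_dis [leRHS]mulrC ler_pdivlMr// /weight_sum mulr_sumr; apply: ler_sum => n _.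
rewrite [leLHS]mulrC ler_wpM2l//; rewrite addrC cos_addint.
have -> : 2 * pi * (a * n%:R) = 2 * pi * ((a - z%:~R) * n%:R) + 2 * pi * (z * n)%:~R :> R.
  by rewrite intrM -pmulrn; ring.
rewrite cos_addint; apply: hd; apply: le_trans hz.
have p0 : 0 <= 2 * pi :> R by rewrite mulr_ge0// pi_ge0.
by rewrite normrM (ger0_norm p0) normrM normr_nat; do 2!apply: ler_wpM2l => //;
  rewrite ?ler_nat// ltnW.
Qed.

Hypothesis Delta_gt0 : forall x, 1 <= x -> 0 < Delta x.
Variable zeta : R.
Hypotheses (b1 : 1 <= beta) (z0 : 0 < zeta) (zb : zeta < beta^-1)
  (Delta_le : forall x, 1 <= x -> Delta x <= expR (x `^ zeta)).

Let inv_Delta (N : nat) (eps x : R) : 0 < eps -> (0 < N)%N ->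
  x <= eps / expR (N%:R `^ zeta) -> x <= eps / Delta N%:R.
Proof.
move=> e0 N0 /le_trans; apply; rewrite ler_pM2l// lef_pV2 ?posrE ?expR_gt0//.
  by apply: Delta_le; rewrite ler1n.
by apply: Delta_gt0; rewrite ler1n.
Qed.

(** The number m of summations by parts comes from [gevrey_decay] and varies with N. The threshold
    [N0] is uniform in the phase, so it serves all starting points at once. *)
Lemma avg_dis_decay a eps : (forall z : int, a != z%:~R) -> 0 < eps ->
  exists N0 : nat, forall N phi, (N0 <= N)%N -> `|avg_dis w N a phi| <= eps / Delta N%:R.
Proof.
move=> az e0; have sa := sin_pi_neq0 _ az.
have [C [lambda [C0 l0 HB]]] := weight_derive_bound _ _ hw.
have [c c0 [N1 H1]] := weight_sum_ge _ _ hw.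
have [[_ dw _ _] _ _] := hw.
have s0 : 0 < `|2 * sin (pi * a)| by rewrite normr_gt0 mulf_neq0.
have ci : 0 < c^-1 by rewrite invr_gt0.
have [N2 H2] := @gevrey_decay R beta zeta (c^-1 * C * lambda)
  (lambda / `|2 * sin (pi * a)|) eps b1 z0 zb
  (mulr_gt0 (mulr_gt0 ci C0) l0) (divr_gt0 l0 s0) e0.
exists (maxn N1 N2) => N phi; rewrite geq_max => /andP[/H1[N0 cA] /H2[m]].
move=> H; apply: (inv_Delta _ _ _ e0 N0); apply: le_trans H.
have Ap : 0 < weight_sum w N by apply: lt_le_trans cA.
rewrite /avg_dis normrM (ger0_norm (_ : 0 <= (weight_sum w N)^-1)) ?invr_ge0 ?(ltW Ap)//.
rewrite (eq_bigr (fun n : 'I_N => w (n%:R / N%:R) * cos (2 * (pi * a) * n%:R + phi))); last first.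
  by move=> n _; congr (_ * cos _); ring.
have M0 : 0 <= m.+1%:R `^ (m.+1%:R * beta) by exact: powR_ge0.
set s := `|2 * sin (pi * a)| in s0 *.
have Nr0 : 0 < N%:R :> R by rewrite ltr0n.
set B := C * lambda ^+ m.+1 * (m.+1%:R `^ (m.+1%:R * beta)).
have B0 : 0 <= B by rewrite !mulr_ge0 ?exprn_ge0 ?(ltW C0) ?(ltW l0).
apply: (@le_trans _ _ (c^-1 * ((N + m)%:R * (s^-1 / N%:R) ^+ m * B))).
  apply: ler_pM => //.
  - by rewrite invr_ge0 ltW.
  - by rewrite lef_pV2.
  - apply: discrete_decay => //.
    by move=> x; exact: (weight_supp _ _ 0 _ hw).
rewrite le_eqVlt; apply/orP; left; apply/eqP.
have -> : lambda / s / N%:R = s^-1 / N%:R * lambda by rewrite -mulrA mulrC.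
rewrite [(_ * lambda) ^+ m]exprMn /B (exprS lambda).
by move: ((s^-1 / N%:R) ^+ m) (lambda ^+ m) => Q L; ring.
Qed.

Lemma cont_weight_cos (T a phi : R) :
  continuous (fun s : R => w (s / T) * cos (phi + 2 * pi * (a * s))).
Proof.
have [[_ dw _ _] _ _] := hw.
have cw : continuous w := derivable_continuous _ (dw 0%N).
move=> x; apply: cvgM.
  apply: continuous_comp; last exact: cw.
  by apply: cvgM; [exact: cvg_id|exact: cvg_cst].
apply: continuous_comp; last exact: continuous_cos.
apply: cvgD; first exact: cvg_cst.
apply: cvgM; first exact: cvg_cst.
by apply: cvgM; [exact: cvg_cst|exact: cvg_id].
Qed.

Lemma avg_conE (T a phi : R) : 0 < T -> avg_con w T a phi =
  \int[lebesgue_measure]_(x in `[0, 1]) (w x * cos (2 * pi * a * T * x + phi)).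
Proof.
move=> T0; rewrite /avg_con Rintegral_rescale//; last exact: cont_weight_cos.
apply: eq_Rintegral => x _; congr (w _ * cos _); last by ring.
by rewrite mulrC mulKf// lt0r_neq0.
Qed.

Let Rintegral_w : \int[lebesgue_measure]_(x in `[0, 1]) w x = 1.
Proof. by have [[_ _ _ w1] _ _] := hw; rewrite /Rintegral w1. Qed.

Let cw : continuous w.
Proof. by have [[_ dw _ _] _ _] := hw; exact: derivable_continuous _ (dw 0%N). Qed.

Let cwc a phi : continuous (fun x => w x * cos (a * x + phi)).
Proof.
move=> x; apply: cvgM; first exact: cw.
apply: continuous_comp; last exact: continuous_cos.
apply: cvgD; last exact: cvg_cst.
by apply: cvgM; [exact: cvg_cst|exact: cvg_id].
Qed.

Lemma avg_con_le1 (T a phi : R) : 0 < T -> `|avg_con w T a phi| <= 1.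
Proof.
move=> T0; rewrite avg_conE//.
apply: (le_trans (le_normr_Rintegral _ (continuous_integrable_itv _ _ _ (cwc _ _)))) => //.
rewrite -[leRHS]Rintegral_w; apply: le_Rintegral => //.
- apply: continuous_integrable_itv => x.
  by apply: cvg_norm; exact: cwc.
- exact: continuous_integrable_itv.
- move=> x _; rewrite normrM (ger0_norm (w_ge0 _)) -[leRHS]mulr1 ler_wpM2l//.
  by rewrite ler_norml cos_geN1 cos_le1.
Qed.

(** At real times an integer part of the frequency does not drop out of the phase, so [a] itself
    must be small; only the initial phase may contain an integer. *)
Lemma avg_con_ge d (T a : R) (z : int) : (forall x : R, `|x| <= d -> 1 / 2 <= cos x) ->
  0 < T -> 2 * pi * (`|a| * T) <= d -> 1 / 2 <= avg_con w T a (2 * pi * z%:~R).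
Proof.
move=> hd T0 aT; rewrite avg_conE//.
rewrite -[leLHS]mul1r -[X in X * _]Rintegral_w -RintegralZr//;
  last exact: continuous_integrable_itv.
have p0 : 0 <= 2 * pi :> R by rewrite mulr_ge0// pi_ge0.
apply: le_Rintegral => //.
- by apply: continuous_integrable_itv => x; apply: cvgM; [exact: cw|exact: cvg_cst].
- by apply: continuous_integrable_itv; exact: cwc.
- move=> x /=; rewrite in_itv/= => /andP[x0 x1]; rewrite ler_wpM2l// cos_addint.
  apply: hd; apply: le_trans aT.
  rewrite !normrM (ger0_norm (pi_ge0 R)) (ger0_norm (ltW T0)) (ger0_norm x0) normr_nat.
  have pi0 := pi_ge0 R; rewrite -!mulrA; do 3!apply: ler_wpM2l => //.
  by rewrite -[leRHS]mulr1 ler_wpM2l// ltW.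
Qed.

Lemma avg_con_decay a eps : a != 0 -> 0 < eps ->
  exists N0 : nat, forall (N : nat) phi, (N0 <= N)%N ->
    `|avg_con w N%:R a phi| <= eps / Delta N%:R.
Proof.
move=> a0 e0.
have [C [lambda [C0 l0 HB]]] := weight_derive_bound _ _ hw.
have [[_ dw _ _] w01 _] := hw.
pose s : R := `|2 * pi * a|.
have s0 : 0 < s by rewrite normr_gt0 !mulf_neq0// lt0r_neq0// pi_gt0.
have [N2 H2] := @gevrey_decay R beta zeta (C * lambda)
  (lambda / s) eps b1 z0 zb (mulr_gt0 C0 l0) (divr_gt0 l0 s0) e0.
exists (maxn 1 N2) => N phi; rewrite geq_max => /andP[N0 /H2[m]].
move=> H; apply: (inv_Delta _ _ _ e0 N0); apply: le_trans H.
have Nr0 : 0 < N%:R :> R by rewrite ltr0n.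
rewrite avg_conE//.
have h0 : 2 * pi * a * N%:R != 0.
  by apply: mulf_neq0; [rewrite -normr_gt0|exact: lt0r_neq0].
apply: (le_trans (integral_cos_by_parts _ _ _ _ dw w01 (HB m) h0 phi)).
have M0 : 0 <= m.+1%:R `^ (m.+1%:R * beta) by exact: powR_ge0.
rewrite normrM -/s normr_nat invfM.
have -> : lambda / s / N%:R = s^-1 / N%:R * lambda by rewrite -mulrA mulrC.
rewrite [(_ * lambda) ^+ m]exprMn (exprS lambda).
rewrite [leLHS](_ : _ = C * lambda * (((s^-1 / N%:R) ^+ m) * lambda ^+ m) *
  (m.+1%:R `^ (m.+1%:R * beta))); last by ring.
rewrite [leRHS](_ : _ = (N + m)%:R * (C * lambda * (((s^-1 / N%:R) ^+ m) * lambda ^+ m) *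
  (m.+1%:R `^ (m.+1%:R * beta)))); last by ring.
(* The integral carries no factor [N + m]; it is inserted so that [gevrey_decay] serves both kinds
   of averages. *)
rewrite -[leLHS]mul1r; apply: ler_wpM2r; last by rewrite ler1n addn_gt0 N0.
by rewrite !mulr_ge0 ?exprn_ge0 ?divr_ge0 ?invr_ge0 ?(ltW C0) ?(ltW l0) ?(ltW s0).
Qed.

End averages.

(** * Dominated series *)

Section series_bounds.
Context {R : realType}.
Implicit Types a u : R^nat.

Lemma dominated_series_cvg a u : cvgn (series a) -> (forall n, `|u n| <= a n) ->
  cvgn (series u).
Proof.
move=> ca ua; apply: normed_cvg; apply: (series_le_cvg _ _ ua ca) => n //.
exact: le_trans (ua n).
Qed.

Lemma dominated_series_le a u : cvgn (series a) -> (forall n, `|u n| <= a n) ->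
  `|limn (series u)| <= limn (series a).
Proof.
move=> ca ua.
have cn : cvgn [normed series u].
  by apply: (series_le_cvg _ _ ua ca) => n //; exact: le_trans (ua n).
by apply: le_trans (lim_series_norm cn) _; apply: lim_series_le.
Qed.

Lemma dominated_series_tail a u M : cvgn (series a) -> (forall n, `|u n| <= a n) ->
  `|limn (series u) - series u M| <= limn (series a) - series a M.
Proof.
move=> ca ua; have cu := dominated_series_cvg _ _ ca ua.
have -> : limn (series u) - series u M = limn (series u \- cst (series u M)).
  by rewrite limB//; [rewrite lim_cst|exact: is_cvg_cst].
have -> : limn (series a) - series a M = limn (series a \- cst (series a M)).
  by rewrite limB//; [rewrite lim_cst|exact: is_cvg_cst].
have c1 : cvgn (series u \- cst (series u M)) by apply: is_cvgB => //; exact: is_cvg_cst.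
have c2 : cvgn (series a \- cst (series a M)) by apply: is_cvgB => //; exact: is_cvg_cst.
rewrite -lim_norm//; apply: ler_lim => //; first exact: is_cvg_norm.
near=> n; have Mn : (M <= n)%N by near: n; exact: nbhs_infty_ge.
rewrite /= !sub_series_geq//; apply: le_trans (ler_norm_sum _ _ _) _.
exact: ler_sum.
Unshelve. all: by end_near. Qed.

Lemma mul_lim_series (x : R) u : cvgn (series u) ->
  x * limn (series u) = limn (series (fun n => x * u n)).
Proof. by move=> cu; rewrite -[LHS]/(x *: limn (series u)) -lim_seriesZ. Qed.

Lemma sum_lim_series {I : Type} (s : seq I) (u : I -> R^nat) :
  (forall i, cvgn (series (u i))) ->
  \sum_(i <- s) limn (series (u i)) = limn (series (fun n => \sum_(i <- s) u i n)).
Proof.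
move=> cu.
suff [_ ->//] : cvgn (series (fun n => \sum_(i <- s) u i n)) /\
  \sum_(i <- s) limn (series (u i)) = limn (series (fun n => \sum_(i <- s) u i n)).
elim: s => [|i s [IH1 IH2]].
  under eq_fun do rewrite big_nil.
  rewrite big_nil (_ : series _ = cst 0); last first.
    by apply/funext => n; rewrite /series/= big1.
  by split; [exact: is_cvg_cst|rewrite lim_cst].
under eq_fun do rewrite big_cons.
rewrite big_cons IH2; split; first exact: (is_cvg_seriesD (cu i) IH1).
by rewrite -lim_seriesD.
Qed.

(** Dominated convergence for series. A general filter lets it serve continuity, difference
    quotients and unordered sums alike. *)
Lemma tannery {T : Type} {F : set_system T} {FF : Filter F} a (u : T -> R^nat) (l : R^nat) :
  cvgn (series a) -> (forall t n, `|u t n| <= a n) -> (forall n, `|l n| <= a n) ->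
  (forall n, u t n @[t --> F] --> l n) ->
  limn (series (u t)) @[t --> F] --> limn (series l).
Proof.
move=> ca ua la ul; apply/cvgrPdist_le => e e0.
have e3 : 0 < e / 3 by rewrite divr_gt0.
have /cvgrPdist_le/(_ _ e3)[M _ HM] := ca.
have tail (v : R^nat) : (forall n, `|v n| <= a n) -> `|limn (series v) - series v M| <= e / 3.
  move=> va; apply: le_trans (dominated_series_tail _ _ M ca va) _.
  apply: le_trans (ler_norm _) _; exact: HM M (leqnn M).
have fin : series (u t) M @[t --> F] --> series l M.
  rewrite /series/=; elim: M {HM tail} => [|M IH].
    rewrite big_geq//; under eq_cvg do rewrite big_geq//.
    exact: cvg_cst.
  rewrite big_nat_recr//=; under eq_cvg do rewrite big_nat_recr//=.
  exact: cvgD.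
move/cvgrPdist_le : fin => /(_ _ e3); apply: filterS => t Ht.
have -> : limn (series l) - limn (series (u t)) =
  (limn (series l) - series l M) + (series l M - series (u t) M)
    - (limn (series (u t)) - series (u t) M) by ring.
apply: le_trans (ler_normB _ _) _.
have H1 := tail _ la; have H2 := tail _ (ua t).
have := ler_normD (limn (series l) - series l M) (series l M - series (u t) M).
by move: Ht H1 H2; lra.
Qed.

Lemma le_integrable_cst {d} {T : measurableType d} (mu : {measure set T -> \bar R})
    (D : set T) (f : T -> R) (M : R) :
  measurable D -> (mu D < +oo)%E -> measurable_fun D f -> (forall x, D x -> `|f x| <= M) ->
  mu.-integrable D (EFin \o f).
Proof.
move=> mD muD mf fM.
have icst : mu.-integrable D (EFin \o cst M).
  apply/integrableP; split; first by apply/measurable_EFinP; exact: measurable_cst.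
  by rewrite (eq_integral (cst `|M|%:E))// integral_cst// lte_mul_pinfty.
apply: (le_integrable mD _ _ icst); first exact/measurable_EFinP.
by move=> x Dx /=; rewrite lee_fin; apply: le_trans (ler_norm _); exact: fM.
Qed.

(** On a set of finite measure the constant [limn (series a)] is an integrable majorant of all
    partial sums, so dominated convergence applies. *)
Lemma Rintegral_series {d} {T : measurableType d} (mu : {measure set T -> \bar R})
    (D : set T) (f : nat -> T -> R) a :
  measurable D -> (mu D < +oo)%E -> cvgn (series a) ->
  (forall n, measurable_fun D (f n)) -> (forall n x, D x -> `|f n x| <= a n) ->
  \int[mu]_(x in D) limn (series (f ^~ x)) = limn (series (fun n => \int[mu]_(x in D) f n x)).
Proof.
move=> mD muD ca mf fa.
have a0 n : D !=set0 -> 0 <= a n by move=> [x Dx]; apply: le_trans (fa n x Dx).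
(* Nonnegativity of [a] follows from the bound only if [D] has a point. *)
have [->|D0] := eqVneq D set0.
  rewrite Rintegral_set0; under eq_fun do rewrite Rintegral_set0.
  rewrite (_ : series _ = cst 0) ?lim_cst//.
  by apply/funext => n; rewrite /series/= big1.
have {}a0 n : 0 <= a n by apply: a0; apply/set0P.
have icst (r : R) : mu.-integrable D (EFin \o cst r).
  by apply: (le_integrable_cst _ _ _ `|r|) => //; exact: measurable_cst.
have ifn n : mu.-integrable D (EFin \o f n).
  by apply: (le_integrable_cst _ _ _ (a n)) => // x Dx; exact: fa.
have isum M : mu.-integrable D (EFin \o (fun x => series (f ^~ x) M)) /\
    \int[mu]_(x in D) series (f ^~ x) M = series (fun n => \int[mu]_(x in D) f n x) M.
  rewrite /series/=; elim: M => [|M [IH1 IH2]].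
    rewrite big_geq//; split.
      by under [X in _ \o X]eq_fun do rewrite big_geq//; exact: icst.
    by under eq_Rintegral do rewrite big_geq//; rewrite Rintegral_cst// mul0r.
  rewrite big_nat_recr//=; split.
    under [X in _ \o X]eq_fun do rewrite big_nat_recr//=.
    exact: (integrableD mD IH1 (ifn M)).
  by under eq_Rintegral do rewrite big_nat_recr//=; rewrite RintegralD// IH2.
have cf x : D x -> cvgn (series (f ^~ x)).
  by move=> Dx; apply: (dominated_series_cvg _ _ ca) => n; exact: fa.
have sle M x : D x -> `|series (f ^~ x) M| <= limn (series a).
  move=> Dx; apply: le_trans (ler_norm_sum _ _ _) _.
  apply: (@le_trans _ _ (series a M)); first by apply: ler_sum => n _; exact: fa.
  apply: nondecreasing_cvgn_le => //; apply/nondecreasing_seqP => n.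
  by rewrite /series/= big_nat_recr//= lerDl.
apply/esym/cvg_lim => //.
under eq_cvg do rewrite -(isum _).2.
have isum_lim : mu.-integrable D (EFin \o (fun x => limn (series (f ^~ x)))).
  apply: (le_integrable mD _ _ (icst (limn (series a)))).
    apply/measurable_EFinP; apply: (measurable_fun_cvg (h := fun M x => series (f ^~ x) M)).
      by move=> M; have [/(measurable_int mu)/measurable_EFinP] := isum M.
    by move=> x Dx; exact: cf.
  move=> x Dx /=; rewrite lee_fin; apply: le_trans (ler_norm _).
  by apply: dominated_series_le => // n; exact: fa.
apply: fine_cvg; rewrite fineK; last exact: integrable_fin_num.
apply: (@dominated_cvg _ _ _ mu D mD (fun M x => (series (f ^~ x) M)%:E) _
  (cst (limn (series a))%:E)) => //.
- by move=> M; have [/(measurable_int mu)] := isum M.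
- by move=> x Dx; apply: cvg_EFin; [exact: nearW|exact: cf].
- exact: icst.
Qed.

End series_bounds.

(** * Trigonometric series *)

Lemma pairingDr {R : realType} d (k : 'rV[int]_d) (x y : 'rV[R]_d) :
  pairing k (x + y) = pairing k x + pairing k y.
Proof. by rewrite /pairing -big_split; apply: eq_bigr => i _; rewrite mxE mulrDr. Qed.

Lemma pairingZr {R : realType} d (k : 'rV[int]_d) (h : R) (x : 'rV[R]_d) :
  pairing k (h *: x) = h * pairing k x.
Proof. by rewrite /pairing mulr_sumr; apply: eq_bigr => i _; rewrite mxE mulrCA. Qed.

Lemma pairing_delta {R : realType} d (k : 'rV[int]_d) (i : 'I_d) :
  pairing k (delta_mx ord0 i : 'rV[R]_d) = (k ord0 i)%:~R.
Proof.
rewrite /pairing (bigD1 i)//= big1 ?addr0 => [|j ji].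
  by rewrite mxE !eqxx mulr1.
by rewrite mxE eqxx/= (negPf ji) mulr0.
Qed.

Lemma continuous_pairing {R : realType} d (k : 'rV[int]_d) :
  continuous (pairing k : 'rV[R]_d -> R).
Proof.
have cf i : continuous (fun x : 'rV[R]_d => (k ord0 i)%:~R * x ord0 i : R).
  move=> x; apply: (@cvgM R 'rV[R]_d (nbhs x) _ (fun=> (k ord0 i)%:~R)
    (fun x : 'rV[R]_d => x ord0 i)).
    exact: cvg_cst.
  exact: (@coord_continuous R 1 d).
by apply: continuous_big => //; exact: add_continuous.
Qed.

Lemma int_norm_ge d (k : 'rV[int]_d) i : (`|k ord0 i|%N <= int_norm k)%N.
Proof. exact: (leq_bigmax i). Qed.

Lemma int_norm_gt0 d (k : 'rV[int]_d) : k != 0 -> (0 < int_norm k)%N.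
Proof.
rewrite lt0n; apply: contraNneq => k0; apply/eqP/rowP => i; rewrite mxE.
by apply/eqP; rewrite -absz_eq0 -leqn0; have := int_norm_ge d k i; rewrite k0.
Qed.

Lemma dist_cos_le {R : realType} (x s : R) : `|cos (x + s) - cos x| <= `|s|.
Proof.
wlog s0 : x s / 0 <= s.
  move=> H; have [|s0] := leP 0 s; first exact: H.
  have := H (x + s) (- s); rewrite addrK normrN distrC; apply.
  by rewrite oppr_ge0 ltW.
have xs : x <= x + s by rewrite lerDl.
have [c _ ->] := MVT_segment xs (fun y _ => is_derive_cos y)
  (continuous_subspaceT (@continuous_cos R)).
rewrite [x + s]addrC addrK normrM normrN -[leRHS]mul1r ler_wpM2r//.
by rewrite ler_norml sin_geN1 sin_le1.
Qed.

Section trigonometric_series.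
Context {R : realType} {d : nat} (kappa : nat -> 'rV[int]_d).
Implicit Types (a b : R^nat) (phi : R) (x : 'rV[R]_d).

(** The phase closes the family under partial derivatives, each of which adds pi / 2 to it. *)
Definition trigsum (a : R^nat) (phi : R) (x : 'rV[R]_d) : R :=
  limn (series (fun n => a n * cos (2 * pi * pairing (kappa n) x + phi))).

Lemma norm_mulcos_le (c t : R) : `|c * cos t| <= `|c|.
Proof. by rewrite normrM -[leRHS]mulr1 ler_wpM2l// ler_norml cos_geN1 cos_le1. Qed.

Lemma continuous_trigsum a phi : cvgn (series (fun n => `|a n|)) ->
  continuous (trigsum a phi).
Proof.
move=> ca x.
apply: (@tannery R 'rV[R]_d (nbhs x) (nbhs_filter x) _
  (fun y n => a n * cos (2 * pi * pairing (kappa n) y + phi)) _ ca) => [t n|n|n].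
- exact: norm_mulcos_le.
- exact: norm_mulcos_le.
- have cc : continuous (fun t : R => a n * cos (2 * pi * t + phi)).
    move=> t; apply: cvgM; first exact: cvg_cst.
    apply: continuous_comp; last exact: continuous_cos.
    apply: cvgD; last exact: cvg_cst.
    by apply: cvgM; [exact: cvg_cst|exact: cvg_id].
  exact: (continuous_comp (@continuous_pairing R d (kappa n) x) (cc _)).
Qed.

(** Cosine being 1-Lipschitz, the difference quotients of the modes are dominated uniformly in h,
    and [tannery] takes the limit term by term. *)
Lemma is_derive_trigsum a phi (i : 'I_d) (x : 'rV[R]_d) :
  cvgn (series (fun n => `|a n|)) ->
  cvgn (series (fun n => `|a n| * (int_norm (kappa n))%:R)) ->
  is_derive x (delta_mx ord0 i) (trigsum a phi)
    (trigsum (fun n => a n * (2 * pi * (kappa n ord0 i)%:~R)) (phi + pi / 2) x).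
Proof.
move=> ca cb.
pose b n : R := 2 * pi * (kappa n ord0 i)%:~R.
pose th n := 2 * pi * pairing (kappa n) x + phi.
pose q (h : R) n := a n * (h^-1 * (cos (th n + h * b n) - cos (th n))).
pose B n := 2 * pi * (`|a n| * (int_norm (kappa n))%:R).
have p0 : 0 <= 2 * pi :> R by rewrite mulr_ge0// pi_ge0.
have bB n : `|a n| * `|b n| <= B n.
  rewrite /b normrM (ger0_norm p0) mulrCA /B; do 2!apply: ler_wpM2l => //.
  by rewrite -intr_norm -abszE -pmulrn ler_nat int_norm_ge.
have cB : cvgn (series B).
  rewrite (_ : B = (2 * pi) *: (fun n => `|a n| * (int_norm (kappa n))%:R))//.
  exact: is_cvg_seriesZ.
have qB h n : `|q h n| <= B n.
  apply: le_trans (bB n); rewrite /q normrM ler_wpM2l//.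
  (* [tannery] asks for the bound at every [h], including 0, where [h^-1] is 0. *)
  have [->|h0] := eqVneq h 0; first by rewrite invr0 mul0r normr0.
  rewrite normrM normfV ler_pdivrMl ?normr_gt0//.
  by apply: le_trans (dist_cos_le _ _) _; rewrite normrM.
have lim_q : limn (series (q h)) @[h --> 0^'] -->
    trigsum (fun n => a n * b n) (phi + pi / 2) x.
  apply: (tannery _ _ _ cB) => // n.
    by apply: le_trans (norm_mulcos_le _ _) _; rewrite normrM.
  have dc : is_derive (0 : R) 1 (fun h => cos (th n + h * b n)) (- sin (th n) * b n).
    have dl : is_derive (0 : R) 1 (fun h : R => th n + h * b n) (b n).
      by apply: is_derive_eq; rewrite scaler0 !add0r mul1r; exact: mulr1.
    have := @is_derive1_comp R cos (fun h => th n + h * b n) 0 _ _ _ dl.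
    by apply; rewrite mul0r addr0; exact: is_derive_cos.
  rewrite -mulrA [b n * _]mulrC; apply: cvgM; first exact: cvg_cst.
  rewrite addrA cosDpihalf.
  case: dc => dc1 dc2; rewrite -dc2.
  apply: cvg_trans dc1; apply: near_eq_cvg; near=> h.
  by rewrite /= addr0 mul0r addr0 /GRing.scale/= mulr1.
have E h : h^-1 *: ((trigsum a phi \o shift x) (h *: delta_mx ord0 i) - trigsum a phi x) =
    limn (series (q h)).
  rewrite /trigsum/= -lim_seriesB; last 2 first.
  - by apply: (dominated_series_cvg _ _ ca) => n; exact: norm_mulcos_le.
  - by apply: (dominated_series_cvg _ _ ca) => n; exact: norm_mulcos_le.
  rewrite -lim_seriesZ; last first.
    apply: is_cvg_seriesB.
    - by apply: (dominated_series_cvg _ _ ca) => n; exact: norm_mulcos_le.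
    - by apply: (dominated_series_cvg _ _ ca) => n; exact: norm_mulcos_le.
  congr (limn (series _)); apply/funext => n.
  rewrite [LHS](_ : _ = h^-1 *
    (a n * cos (2 * pi * pairing (kappa n) (h *: delta_mx ord0 i + x) + phi)
     - a n * cos (2 * pi * pairing (kappa n) x + phi)))//.
  rewrite /q pairingDr pairingZr pairing_delta.
  have -> : 2 * pi * (h * (kappa n ord0 i)%:~R + pairing (kappa n) x) + phi = th n + h * b n.
    by rewrite /th /b; ring.
  by rewrite -mulrBr mulrCA.
have dE : h^-1 *: ((trigsum a phi \o shift x) (h *: delta_mx ord0 i) - trigsum a phi x)
    @[h --> 0^'] --> trigsum (fun n => a n * b n) (phi + pi / 2) x.
  by under eq_cvg do rewrite E.
apply: DeriveDef; first by apply/cvg_ex; eexists; exact: dE.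
exact: cvg_lim dE.
Unshelve. all: by end_near. Qed.

(** Each derivative costs one factor [int_norm (kappa n)] and changes coefficients and phase, so the
    induction keeps both free. *)
Lemma class_C_trigsum (r : nat) a phi : (forall n, kappa n != 0) ->
  cvgn (series (fun n => `|a n| * (int_norm (kappa n))%:R ^+ r)) ->
  class_C r (trigsum a phi).
Proof.
move=> k0.
have k1 n : 1 <= (int_norm (kappa n))%:R :> R by rewrite ler1n int_norm_gt0.
have lower p q (b : R^nat) : (p <= q)%N ->
    cvgn (series (fun n => `|b n| * (int_norm (kappa n))%:R ^+ q)) ->
    cvgn (series (fun n => `|b n| * (int_norm (kappa n))%:R ^+ p :> R)).
  move=> pq cb; apply: (dominated_series_cvg _ _ cb) => n.
  by rewrite ger0_norm ?mulr_ge0// ler_wpM2l// ler_weXn2l.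
elim: r a phi => [|r IH] a phi ca /=.
  by apply: continuous_trigsum; move: ca; under eq_fun do rewrite expr0 mulr1.
have ca0 : cvgn (series (fun n => `|a n|)).
  have /= := lower 0%N _ _ (leq0n _) ca.
  by under eq_fun do rewrite expr0 mulr1.
have ca1 : cvgn (series (fun n => `|a n| * (int_norm (kappa n))%:R)).
  have /= := lower 1%N _ _ (ltn0Sn r) ca.
  by under eq_fun do rewrite expr1.
split; first exact: continuous_trigsum.
move=> i; split.
  by move=> x; case: (is_derive_trigsum a phi i x ca0 ca1).
rewrite (_ : (fun x => _) =
    trigsum (fun n => a n * (2 * pi * (kappa n ord0 i)%:~R)) (phi + pi / 2)); last first.
  by apply/funext => x; case: (is_derive_trigsum a phi i x ca0 ca1).
apply: IH.
have cz := @is_cvg_seriesZ R _ (2 * pi) ca.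
apply: (dominated_series_cvg _ _ cz) => n.
have p0 : 0 <= 2 * pi :> R by rewrite mulr_ge0// pi_ge0.
rewrite ger0_norm ?mulr_ge0 ?exprn_ge0// !normrM (ger0_norm (pi_ge0 R)) normr_nat.
rewrite [leRHS](_ : _ = 2 * pi * (`|a n| * (int_norm (kappa n))%:R ^+ r.+1))//.
rewrite exprS [leRHS]mulrCA -[leLHS]mulrA; apply: ler_wpM2l => //.
rewrite -!mulrA; do 2!(apply: ler_wpM2l; rewrite ?pi_ge0//).
by rewrite ler_wpM2r ?exprn_ge0// -intr_norm -abszE -pmulrn ler_nat int_norm_ge.
Qed.

End trigonometric_series.

(** * Integration over the unit cube *)

Section tuple_integrals.
Context {R : realType}.
Local Notation RT := (measurableTypeR R).

(** This is [pairing] on tuples. Coefficients are a function of the index, so that splitting off the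
    first coordinate, as in [lebesgue_tuple], is composition with [lift ord0]. *)
Definition linform {n} (c : 'I_n -> int) (t : n.-tuple RT) : R :=
  \sum_i (c i)%:~R * tnth t i.

Lemma linform_cons n (c : 'I_n.+1 -> int) (x : RT) (t : n.-tuple RT) :
  linform c (consp (x, t)) = (c ord0)%:~R * x + linform (fun i => c (lift ord0 i)) t.
Proof.
rewrite /linform big_ord_recl; congr (_ + _).
by apply: eq_bigr => i _; rewrite tnthS.
Qed.

Lemma measurable_linform n (c : 'I_n -> int) :
  measurable_fun setT (linform c : n.-tuple RT -> RT).
Proof.
apply: measurable_sum => i; apply: measurable_funM; first exact: measurable_cst.
exact: measurable_tnth.
Qed.

(** Fubini in the first coordinate: if a later coefficient is nonzero, every section is null by
    induction; otherwise the set is a point times the whole space. *)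
Lemma lebesgue_tuple_linform0 n (c : 'I_n -> int) (m : R) : (exists i, c i != 0) ->
  lebesgue_tuple R n [set t | linform c t = m] = 0%E.
Proof.
have mset k (b : 'I_k -> int) (r : R) : measurable [set t : k.-tuple RT | linform b t = r].
  rewrite [X in measurable X](_ : _ = linform b @^-1` [set r])//.
  by rewrite -[_ @^-1` _]setTI; apply: measurable_linform => //; exact: measurable_set1.
elim: n c m => [|n IH] c m; first by case=> -[].
move=> [i ci]; rewrite /= /lebesgue_cons /pushforward.
have [[j cj]|H] := pselect (exists j, c (lift ord0 j) != 0).
  rewrite /product_measure1; under eq_integral.
    move=> x _; rewrite /= (_ : xsection _ x =
      [set t | linform (fun i => c (lift ord0 i)) t = m - (c ord0)%:~R * x]); last first.
      apply/seteqP; split => t; rewrite /xsection/= inE/= linform_cons.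
        by move=> <-; rewrite addrC addKr.
      by move=> ->; rewrite addrC subrK.
    rewrite IH; last by exists j.
    over.
  by rewrite integral0.
have c0 j : c (lift ord0 j) = 0.
  by apply/eqP; apply/negPn/negP => cj; apply: H; exists j.
have c00 : c ord0 != 0 by case: (unliftP ord0 i) ci => [j ->|-> //]; rewrite c0 eqxx.
rewrite (_ : _ @^-1` _ = [set m / (c ord0)%:~R] `*` setT); last first.
  have l0 t : linform (fun i => c (lift ord0 i)) t = 0 :> R.
    by rewrite /linform big1// => j _; rewrite c0 mul0r.
  apply/seteqP; split => -[x t]; rewrite /= linform_cons l0 addr0.
    by move=> <-; split => //; rewrite mulrC mulKf// intr_eq0.
  by move=> [-> _]; rewrite mulrC divfK// intr_eq0.
by rewrite product_measure1E//= lebesgue_measure_set1 mul0e.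
Qed.

Definition cube n : set (n.-tuple RT) := [set t | forall i, tnth t i \in `[0, 1[].

Lemma measurable_cube n : measurable (@cube n).
Proof.
rewrite (_ : @cube n = \bigcap_(i in [set: 'I_n]) ((@tnth n RT ^~ i) @^-1` `[0, 1[)); last first.
  by apply/seteqP; split => t /= H i; [move=> _; exact: H|exact: (H i I)].
apply: fin_bigcap_measurable => // i _.
by rewrite -[_ @^-1` _]setTI; apply: measurable_tnth.
Qed.

Lemma lebesgue_cube n : lebesgue_tuple R n (@cube n) = 1%E.
Proof.
rewrite (lebesgue_tuple_box (A := fun=> `[0%R, 1%R[%classic))//.
by rewrite big1// => i _; rewrite lebesgue_measure_itv/= lte_fin ltr01 oppr0 adde0.
Qed.

Lemma cube_cons n (x : RT) (t : n.-tuple RT) :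
  @cube n.+1 (consp (x, t)) <-> (x \in `[0, 1[) /\ @cube n t.
Proof.
split=> [H|[x0 H] i].
  by split=> [|i]; [exact: (H ord0)|have := H (lift ord0 i); rewrite tnthS].
by case: (unliftP ord0 i) => [j ->|->]//; rewrite tnthS; exact: H.
Qed.

Lemma measurable_cos_linform n (c : 'I_n -> int) (phi : R) :
  measurable_fun setT (fun t : n.-tuple RT => cos (2 * pi * linform c t + phi) : RT).
Proof.
have mc : measurable_fun setT (fun s : RT => cos (2 * pi * s + phi) : RT).
  apply: continuous_measurable_fun => t.
  apply: continuous_comp; last exact: continuous_cos.
  apply: cvgD; last exact: cvg_cst.
  by apply: cvgM; [exact: cvg_cst|exact: cvg_id].
exact: (measurableT_comp mc (@measurable_linform n c)).
Qed.

Lemma Rintegral_cos_period (k : int) (phi : R) :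
  \int[lebesgue_measure]_(x in `[0, 1[) cos (2 * pi * (k%:~R * x) + phi) =
  if k == 0 then cos phi else 0.
Proof.
have cc (a : R) : continuous (fun x : R => cos (2 * pi * (a * x) + phi)).
  move=> t; apply: continuous_comp; last exact: continuous_cos.
  apply: cvgD; last exact: cvg_cst.
  apply: cvgM; first exact: cvg_cst.
  by apply: cvgM; [exact: cvg_cst|exact: cvg_id].
rewrite Rintegral_itv_bndo_bndc; last first.
  apply: integrableS (continuous_integrable_itv _ 0 1 (cc k%:~R)) => //.
  by apply: subset_itvl; rewrite bnd_simp.
have [->|k0] := eqVneq k 0.
  under eq_Rintegral do rewrite mul0r mulr0 add0r.
  by rewrite Rintegral_cst//= lebesgue_measure_itv/= lte_fin ltr01 -EFinD/= subr0 mulr1.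
have kn : 2 * pi * k%:~R != 0 :> R by rewrite !mulf_neq0 ?intr_eq0// lt0r_neq0 ?pi_gt0.
have ds (x : R) : is_derive x 1 (fun y => (2 * pi * k%:~R)^-1 * sin (2 * pi * (k%:~R * y) + phi))
    (cos (2 * pi * (k%:~R * x) + phi)).
  have dl : is_derive x 1 (fun y : R => 2 * pi * k%:~R * y + phi) (2 * pi * k%:~R).
    by apply: is_derive_eq; rewrite addr0; exact: mulr1.
  have d2 := @is_derive1_comp R sin (fun y => 2 * pi * k%:~R * y + phi) x _ _ (is_derive_sin _) dl.
  have := is_deriveZ (2 * pi * k%:~R)^-1 d2.
  rewrite /GRing.scale/= mulrCA mulVf// mulr1 mulrA => /near_eq_is_derive; apply.
  by near=> y; rewrite /= mulrA.
rewrite /Rintegral (@continuous_FTC2 R _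
  (fun y => (2 * pi * k%:~R)^-1 * sin (2 * pi * (k%:~R * y) + phi)) 0 1)//=.
- rewrite !mulr0 add0r mulr1 [X in sin X]addrC.
  have -> : sin (phi + 2 * pi * k%:~R) = sin phi.
    by rewrite -!cosBpihalf addrAC cos_addint.
  by rewrite subrr.
- exact: continuous_subspaceT.
- by apply: derivable_LRcontinuous => x; case: (ds x).
- by move=> x _; rewrite derive1E; case: (ds x).
Unshelve. all: by end_near. Qed.

(** The phase is free in the induction because, while the other coordinates are integrated, the
    first one only contributes to the phase. *)
Lemma Rintegral_cos_linform n (c : 'I_n -> int) (phi : R) :
  \int[lebesgue_tuple R n]_(t in @cube n) cos (2 * pi * linform c t + phi) =
  if [forall i, c i == 0] then cos phi else 0.
Proof.
elim: n c phi => [|n IH] c phi.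
  rewrite /Rintegral /= integral_dirac//; last 2 first.
  - exact: measurable_cube.
  - by apply/measurable_EFinP; apply: measurable_funTS; exact: measurable_cos_linform.
  rewrite diracE mem_set ?mul1e/=; last by case.
  rewrite /linform big_ord0 mulr0 add0r; case: forallP => // H.
  by exfalso; apply: H; case.
pose c' i := c (lift ord0 i).
pose f (t : n.+1.-tuple RT) := cos (2 * pi * linform c t + phi) : R.
have f1 t : `|f t| <= 1 by rewrite ler_norml cos_geN1 cos_le1.
have mf : measurable_fun setT (f : n.+1.-tuple RT -> RT) by exact: measurable_cos_linform.
set D := @consp R n @^-1` @cube n.+1.
have Lc : (lebesgue_tuple R n (@cube n) < +oo)%E by rewrite lebesgue_cube ltry.
have mcons := @measurable_consp R n.
have mD : measurable D by rewrite -[D]setTI; apply: mcons => //; exact: measurable_cube.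
have Dfin : ((@lebesgue_measure R \x lebesgue_tuple R n) D < +oo)%E.
  by have := lebesgue_cube n.+1; rewrite /= /lebesgue_cons /pushforward => ->; rewrite ltry.
have mfc : measurable_fun setT (f \o @consp R n) by exact: measurableT_comp.
have ifc : (@lebesgue_measure R \x lebesgue_tuple R n)%E.-integrable D (EFin \o (f \o @consp R n)).
  by apply: (le_integrable_cst _ _ _ 1) => //; [exact: measurable_funTS|move=> x _; exact: f1].
rewrite /Rintegral (eq_measure_integral
  (pushforward (@lebesgue_measure R \x lebesgue_tuple R n)%E (@consp R n)))//.
rewrite integral_pushforward//; [|exact/measurable_EFinP|exact: measurable_cube].
(* The domain moves into the integrand so that Fubini applies to the whole product; its section at x
   is the smaller cube or empty. *)
rewrite -/D integral_mkcond -integral12_prod_meas1;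
  last exact: (proj1 (integrable_mkcond _ mD) ifc).
transitivity (\int[@lebesgue_measure R]_(x in `[0, 1[)
    (if [forall i, c' i == 0] then cos (2 * pi * ((c ord0)%:~R * x) + phi) else 0)).
  rewrite [RHS]/Rintegral [in RHS]integral_mkcond; congr fine; apply: eq_integral => x _.
  rewrite /fubini_F [RHS]/patch.
  have [x01|x01] := boolP (x \in `[0, 1[%classic).
    rewrite -(IH c') /Rintegral fineK; last first.
      apply: integrable_fin_num; first exact: measurable_cube.
      apply: (le_integrable_cst _ _ _ 1).
      - exact: measurable_cube.
      - exact: Lc.
      - by apply: measurable_funTS; exact: measurable_cos_linform.
      - by move=> t _; rewrite ler_norml cos_geN1 cos_le1.
    rewrite [in RHS]integral_mkcond; apply: eq_integral => t _.
    rewrite /patch; have [tc|tc] := boolP (t \in @cube n).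
      rewrite mem_set; last by apply/cube_cons; split; [rewrite inE in x01|rewrite inE in tc].
      by rewrite /= /f linform_cons mulrDr [2 * pi * _ + _ in LHS]addrC addrA.
    rewrite ifF//; apply/negbTE; apply: contra tc; rewrite !inE => /cube_cons[_].
    by [].
  rewrite integral0_eq// => t _; rewrite /patch ifF//.
  by apply/negbTE; apply: contra x01; rewrite !inE => /cube_cons[].
have E : [forall i, c i == 0] = (c ord0 == 0) && [forall i, c' i == 0].
  apply/forallP/andP => [H|[c0 /forallP H] i].
    by split; [exact: H|apply/forallP => j; exact: H].
  by case: (unliftP ord0 i) => [j ->|->]//; exact: H.
rewrite E; case: [forall i, c' i == 0]; first by rewrite andbT Rintegral_cos_period.
by rewrite andbF Rintegral_cst//= mul0r.
Qed.

End tuple_integrals.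

(** * Fourier coefficients of lacunary observables *)

Lemma lim_series_finite {R : realType} (u : R^nat) (M : nat) :
  (forall n, (M <= n)%N -> u n = 0) -> limn (series u) = series u M.
Proof.
move=> u0; apply: cvg_lim => //; apply: cvg_near_cst; near=> n.
have Mn : (M <= n)%N by near: n; exact: nbhs_infty_ge.
apply/eqP; rewrite -subr_eq0 sub_series_geq// big_nat big1// => i /andP[Mi _].
exact: u0.
Unshelve. all: by end_near. Qed.

Lemma sum_delta_mul {R : pzRingType} {I : choiceType} (J : seq I) (i : I) (g : I -> R) :
  uniq J -> \sum_(k <- J) (i == k)%:R * g k = if i \in J then g i else 0.
Proof.
move=> uJ; case: ifPn => iJ.
  rewrite (bigD1_seq i)//= eqxx mul1r big1 ?addr0// => k ki.
  by rewrite eq_sym (negPf ki) mul0r.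
rewrite big_seq big1// => k kJ; have [ik|] := eqVneq i k; last by rewrite mul0r.
by rewrite ik kJ in iJ.
Qed.

Section lacunary_observable.
Import finmap.
Context {R : realType} {d : nat}.
Variables (kappa : nat -> 'rV[int]_d) (c : R^nat).
Hypotheses (k0 : forall n, kappa n != 0)
  (kinj : forall m n, kappa m = kappa n \/ kappa m = - kappa n -> m = n)
  (c_ge0 : forall n, 0 <= c n) (csum : cvgn (series c)).

(** The Fourier coefficient at [k]: 2 c_n times a cosine splits into exponentials at [kappa n] and
    [- kappa n], each with weight c_n. It is kept as a series because termwise integration produces
    it in this form. *)
Definition spectrum (k : 'rV[int]_d) : R :=
  limn (series (fun n => c n * ((kappa n == k)%:R + (- kappa n == k)%:R))).

Let f := trigsum kappa (fun n => 2 * c n) 0.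

Let c2sum : cvgn (series (fun n => 2 * c n)).
Proof. exact: (@is_cvg_seriesZ R _ 2 csum). Qed.

Let pairing_row (k : 'rV[int]_d) (t : d.-tuple (measurableTypeR R)) :
  pairing k (row_of_tuple t) = linform (fun i => k ord0 i) t.
Proof. by apply: eq_bigr => i _; rewrite mxE. Qed.

(** Product-to-sum formula and orthogonality, term by term. The phase [psi] gives the real part of
    the Fourier coefficient at 0 and the imaginary part at - pi / 2. *)
Lemma torus_integral_trigsum_cos (k : 'rV[int]_d) (psi : R) :
  torus_integral (fun x => f x * cos (2 * pi * - pairing k x + psi)) =
  cos psi * spectrum k.
Proof.
have L1 : (lebesgue_tuple R d (@cube R d) < +oo)%E by rewrite lebesgue_cube ltry.
have mcube := @measurable_cube R d.
rewrite /torus_integral -[X in Rintegral _ X]/(@cube R d).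
transitivity (\int[lebesgue_tuple R d]_(t in @cube R d) limn (series (fun n =>
    c n * (cos (2 * pi * linform (fun i => (kappa n - k) ord0 i) t + psi) +
           cos (2 * pi * linform (fun i => (kappa n + k) ord0 i) t - psi))))).
  apply: eq_Rintegral => t _; rewrite mulrC /f /trigsum.
  rewrite mul_lim_series; last first.
    apply: (dominated_series_cvg _ _ c2sum) => n.
    by apply: le_trans (norm_mulcos_le _ _) _; rewrite ger0_norm ?mulr_ge0.
  congr (limn (series _)); apply/funext => n.
  have -> : linform (fun i => (kappa n - k) ord0 i) t =
      pairing (kappa n) (row_of_tuple t) - pairing k (row_of_tuple t).
    by rewrite !pairing_row -sumrB; apply: eq_bigr => i _; rewrite !mxE intrB mulrBl.
  have -> : linform (fun i => (kappa n + k) ord0 i) t =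
      pairing (kappa n) (row_of_tuple t) + pairing k (row_of_tuple t).
    by rewrite !pairing_row -big_split; apply: eq_bigr => i _; rewrite !mxE intrD mulrDl.
  move: (pairing _ _) (pairing _ _) => A B; rewrite addr0.
  rewrite [2 * pi * (A - B) + psi](_ : _ = 2 * pi * A + (2 * pi * - B + psi)); last by ring.
  rewrite [2 * pi * (A + B) - psi](_ : _ = 2 * pi * A - (2 * pi * - B + psi)); last by ring.
  by move: (2 * pi * - B + psi) (2 * pi * A) => Y X; rewrite cosD cosB; ring.
rewrite (Rintegral_series _ _ _ _ mcube L1 c2sum); last 2 first.
- move=> n; apply: measurable_funM; first exact: measurable_cst.
  by apply: measurable_funD; apply: measurable_funTS; exact: measurable_cos_linform.
- move=> n t _; rewrite normrM (ger0_norm (c_ge0 n)) mulrC ler_wpM2r//.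
  apply: le_trans (ler_normD _ _) _; rewrite -[leRHS]/(1 + 1).
  by apply: lerD; rewrite ler_norml cos_geN1 cos_le1.
have icos (b : 'I_d -> int) (ph : R) :
    (lebesgue_tuple R d).-integrable (@cube R d)
      (EFin \o (fun t => cos (2 * pi * linform b t + ph))).
  apply: (le_integrable_cst _ _ _ 1) => //.
    by apply: measurable_funTS; exact: measurable_cos_linform.
  by move=> t _; rewrite ler_norml cos_geN1 cos_le1.
rewrite /spectrum mul_lim_series; last first.
  apply: (dominated_series_cvg _ _ c2sum) => n.
  rewrite ger0_norm ?mulr_ge0 ?addr_ge0// mulrC ler_wpM2r//.
  by rewrite -[leRHS]/(1 + 1); apply: lerD; rewrite lern1 leq_b1.
congr (limn (series _)); apply/funext => n.
rewrite RintegralZl//; last by apply: (integrableD _ (icos _ _) (icos _ _)).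
rewrite RintegralD// !Rintegral_cos_linform cosN.
have vz (v : 'rV[int]_d) : [forall i, v ord0 i == 0] = (v == 0).
  by apply/forallP/eqP => [H|-> i]; [apply/rowP => i; rewrite mxE; exact/eqP|rewrite mxE].
rewrite !vz subr_eq0 addr_eq0 -eqr_oppLR.
by case: (kappa n == k); case: (- kappa n == k); rewrite /=; ring.
Qed.

Lemma fourier_coef_trigsum k : fourier_coef f k = complex.Complex (spectrum k) 0.
Proof.
rewrite /fourier_coef; congr complex.Complex.
  transitivity (torus_integral (fun x => f x * cos (2 * pi * - pairing k x + 0))).
    by congr torus_integral; apply/funext => x; rewrite addr0.
  by rewrite torus_integral_trigsum_cos cos0 mul1r.
transitivity (torus_integral (fun x => f x * cos (2 * pi * - pairing k x + - (pi / 2)))).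
  by congr torus_integral; apply/funext => x; rewrite cosBpihalf.
by rewrite torus_integral_trigsum_cos cosN cos_pihalf mul0r.
Qed.

Lemma torus_integral_trigsum : torus_integral f = 0.
Proof.
transitivity (torus_integral (fun x => f x * cos (2 * pi * - pairing 0 x + 0))).
  congr torus_integral; apply/funext => x.
  rewrite [pairing 0 x]big1 => [|i _]; last by rewrite mxE mul0r.
  by rewrite oppr0 mulr0 addr0 cos0 mulr1.
rewrite torus_integral_trigsum_cos cos0 mul1r /spectrum (lim_series_finite _ 0).
  by rewrite /series/= big_geq.
by move=> n _; rewrite oppr_eq0 (negPf (k0 n)) addr0 mulr0.
Qed.

(** Injectivity up to sign leaves at most one index, and only one of its two terms, since k = - k
    would force k = 0. *)
Lemma spectrum_le (k : 'rV[int]_d) (B : R) : 0 <= B -> k != 0 ->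
  (forall n, kappa n = k \/ kappa n = - k -> c n <= B) -> `|spectrum k| <= B.
Proof.
move=> B0 kn0 cB; rewrite /spectrum.
have [[n0 Hn0]|H] := pselect (exists n, kappa n = k \/ kappa n = - k); last first.
  rewrite (lim_series_finite _ 0) ?/series/= ?big_geq ?normr0// => n _.
  rewrite eqr_oppLR; case: eqP => [kn|_]; first by exfalso; apply: H; exists n; left.
  case: eqP => [kn|_]; first by exfalso; apply: H; exists n; right.
  by rewrite addr0 mulr0.
have z n : n != n0 -> c n * ((kappa n == k)%:R + (- kappa n == k)%:R) = 0.
  move=> nn0; rewrite eqr_oppLR; case: eqP => [kn|_].
    by move/eqP : nn0; case; apply: kinj; case: Hn0 => ->; rewrite kn ?opprK; [left|right].
  case: eqP => [kn|_]; last by rewrite addr0 mulr0.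
  by move/eqP : nn0; case; apply: kinj; case: Hn0 => ->; rewrite kn; [right|left].
rewrite (lim_series_finite _ n0.+1) => [|n n0n]; last by apply: z; rewrite neq_ltn n0n orbT.
rewrite /series/= big_nat_recr//= big_nat big1 => [|n /andP[_ nn0]]; last first.
  by apply: z; rewrite ltn_eqF.
rewrite add0r ger0_norm ?mulr_ge0 ?addr_ge0//.
apply: le_trans (cB _ Hn0); rewrite -[leRHS]mulr1; apply: ler_wpM2l => //.
rewrite -natrD lern1; case: eqP => [kk|_]; last by rewrite add0n leq_b1.
case: eqP => [kk'|//]; exfalso; move: kn0; rewrite -kk => /eqP; apply.
apply/rowP => i; rewrite mxE; have := congr1 (fun v : 'rV[int]_d => v ord0 i) kk'.
rewrite -kk !mxE => /eqP; rewrite eq_sym -addr_eq0 -mulr2n mulrn_eq0/= => /eqP ->.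
by [].
Qed.

(** Regrouped by n, a finite partial sum is a series dominated by 2 c_n whose n-th term is final
    once the finite set contains [kappa n] and [- kappa n]; [tannery] concludes. *)
Lemma partial_sum_spectrum (g : 'rV[int]_d -> R) (l : R^nat) :
  (forall k, `|g k| <= 1) -> (forall n, l n = c n * (g (kappa n) + g (- kappa n))) ->
  summability.partial_sum (fun k => spectrum k * g k) J @[J --> summability.totally] -->
  limn (series l).
Proof.
move=> g1 lE.
pose u (J : {fset 'rV[int]_d}) n : R := c n * ((if kappa n \in J then g (kappa n) else 0) +
  (if - kappa n \in J then g (- kappa n) else 0)).
have E J : summability.partial_sum (fun k => spectrum k * g k) J = limn (series (u J)).
  rewrite /summability.partial_sum -(big_seq_fsetE _ J xpredT (fun k => spectrum k * g k))/=.
  have v_cvg k : cvgn (series (fun n => c n * ((kappa n == k)%:R + (- kappa n == k)%:R) * g k)).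
    apply: (dominated_series_cvg _ _ c2sum) => n.
    rewrite normrM -[leRHS]mulr1; apply: ler_pM => //.
    rewrite ger0_norm ?mulr_ge0 ?addr_ge0// mulrC ler_wpM2r//.
    by rewrite -[leRHS]/(1 + 1); apply: lerD; rewrite lern1 leq_b1.
  have sp k : spectrum k * g k =
      limn (series (fun n => c n * ((kappa n == k)%:R + (- kappa n == k)%:R) * g k)).
    rewrite /spectrum mulrC mul_lim_series; last first.
      apply: (dominated_series_cvg _ _ c2sum) => n.
      rewrite ger0_norm ?mulr_ge0 ?addr_ge0// mulrC ler_wpM2r//.
      by rewrite -[leRHS]/(1 + 1); apply: lerD; rewrite lern1 leq_b1.
    by congr (limn (series _)); apply/funext => n; rewrite [LHS]mulrC.
  under eq_bigr do rewrite sp.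
  rewrite sum_lim_series//.
  congr (limn (series _)); apply/funext => n; rewrite /u.
  rewrite -!(sum_delta_mul _ _ g (fset_uniq J)) -big_split mulr_sumr.
  by apply: eq_bigr => k _; rewrite -mulrA mulrDl.
under eq_cvg do rewrite E.
have g1' (b : bool) k : `|if b then g k else 0| <= 1 by case: b; rewrite ?normr0.
have FF := @filter_filter _ _ (@summability.totally_filter 'rV[int]_d).
apply: (tannery _ _ _ c2sum) => [J n|n|n].
- rewrite /u normrM (ger0_norm (c_ge0 n)) mulrC ler_wpM2r//.
  by apply: le_trans (ler_normD _ _) _; rewrite -[leRHS]/(1 + 1); apply: lerD.
- rewrite lE normrM (ger0_norm (c_ge0 n)) mulrC ler_wpM2r//.
  by apply: le_trans (ler_normD _ _) _; rewrite -[leRHS]/(1 + 1); apply: lerD.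
- apply: cvg_near_cst; exists [fset kappa n; - kappa n]%fset => // J /= /fsubsetP sJ.
  by rewrite lE /u !sJ ?in_fset2 ?eqxx ?orbT.
Qed.

End lacunary_observable.

Lemma int_normN d (k : 'rV[int]_d) : int_norm (- k) = int_norm k.
Proof. by rewrite /int_norm; apply: eq_bigr => i _; rewrite mxE abszN. Qed.

Lemma weight_summable_series {R : realType} (Delta : R -> R) d r (kappa : nat -> 'rV[int]_d) :
  (forall x, 1 <= x -> 0 < Delta x) -> (forall n, kappa n != 0) -> injective kappa ->
  weight_summable Delta d r ->
  cvgn (series (fun n => (int_norm (kappa n))%:R ^+ r / Delta (int_norm (kappa n))%:R)).
Proof.
move=> D0 k0 kinj hs.
have u0 (k : 'rV[int]_d) : k != 0 -> 0 <= (int_norm k)%:R ^+ r / Delta (int_norm k)%:R.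
  by move=> kn0; rewrite divr_ge0 ?exprn_ge0// ltW// D0// ler1n int_norm_gt0.
apply: nnseries_is_cvg => [n|]; first exact: u0.
apply: le_lt_trans hs.
rewrite nneseries_esumT; last by move=> n; rewrite lee_fin u0.
rewrite -(@esum_image _ _ _ setT kappa
  (fun k => ((int_norm k)%:R ^+ r / Delta (int_norm k)%:R)%:E)); last first.
  by move=> m n _ _; exact: kinj.
rewrite [leRHS](esumID (kappa @` setT)); last by move=> k /= kn0; rewrite lee_fin u0.
rewrite [X in (_ <= \esum_(i in X) _ + _)%E](_ : _ = kappa @` setT); last first.
  by apply/seteqP; split => [k []//|k [n _ <-]]; split => //; exact: k0.
by apply: leeDl; apply: esum_ge0 => k [/= kn0 _]; rewrite lee_fin u0.
Qed.

Lemma observable_trigsum {R : realType} (Delta : R -> R) d l (kappa : nat -> 'rV[int]_d) :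
  (forall x, 1 <= x -> 0 < Delta x) -> (forall n, kappa n != 0) ->
  (forall m n, kappa m = kappa n \/ kappa m = - kappa n -> m = n) ->
  weight_summable Delta d 0 ->
  observable_space Delta (fun x => \row_(j < l)
    trigsum kappa (fun n => 2 * (Delta (int_norm (kappa n))%:R)^-1) 0 x).
Proof.
move=> D0 k0 kinj hs.
pose c n := (Delta (int_norm (kappa n))%:R)^-1.
have inj : injective kappa by move=> m n e; apply: kinj; left.
have cp n : 0 < c n by rewrite invr_gt0 D0// ler1n int_norm_gt0.
have c0 n := ltW (cp n).
have csum : cvgn (series c).
  have := weight_summable_series _ _ _ _ D0 k0 inj hs.
  by under eq_fun do rewrite expr0 mul1r.
have fE j : (fun x => (\row_(j < l) trigsum kappa (fun n => 2 * c n) 0 x) ord0 j) =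
    trigsum kappa (fun n => 2 * c n) 0.
  by apply/funext => x; rewrite mxE.
split => //.
- move=> x m; apply/rowP => j; rewrite !mxE /trigsum.
  congr (limn (series _)); apply/funext => n; congr (_ * _).
  rewrite !addr0 pairingDr mulrDr.
  have -> : pairing (kappa n) (intvec R m) = (\sum_i kappa n ord0 i * m ord0 i)%:~R :> R.
    by rewrite /pairing rmorph_sum/=; apply: eq_bigr => i _; rewrite mxE intrM.
  by rewrite cos_addint.
- move=> r hr j; rewrite fE; apply: class_C_trigsum => //.
  have cz := @is_cvg_seriesZ R _ 2 (weight_summable_series _ _ _ _ D0 k0 inj hr).
  apply: (dominated_series_cvg _ _ cz) => n.
  rewrite ger0_norm ?mulr_ge0 ?exprn_ge0// ger0_norm ?mulr_ge0// -mulrA.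
  by rewrite [leRHS](_ : _ =
    2 * ((int_norm (kappa n))%:R ^+ r / Delta (int_norm (kappa n))%:R))// [_ / _]mulrC.
- move=> theta j; rewrite fE.
  under eq_fun do rewrite (fourier_coef_trigsum kappa c)//.
  split => /=.
    under eq_fun do rewrite mul0r subr0.
    rewrite mxE.
    apply: (partial_sum_spectrum kappa c c0 csum
      (fun k => cos (2 * pi * pairing k theta))) => [k|n].
      by rewrite ler_norml cos_geN1 cos_le1.
    rewrite addr0 [pairing (- kappa n) _](_ : _ = - pairing (kappa n) theta).
      by rewrite mulrN cosN -/(c n); ring.
    by rewrite /pairing -sumrN; apply: eq_bigr => i _; rewrite mxE mulrNz mulNr.
  under eq_fun do rewrite mul0r addr0.
  (* Sine is odd, so the contributions of [kappa n] and [- kappa n] to the imaginary part cancel. *)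
  have -> : 0 = limn (series (fun n => c n * (sin (2 * pi * pairing (kappa n) theta) +
      sin (2 * pi * pairing (- kappa n) theta)))) :> R.
    rewrite (lim_series_finite _ 0) ?/series/= ?big_geq// => n _.
    rewrite [pairing (- kappa n) _](_ : _ = - pairing (kappa n) theta).
      by rewrite mulrN sinN subrr mulr0.
    by rewrite /pairing -sumrN; apply: eq_bigr => i _; rewrite mxE mulrNz mulNr.
  apply: (partial_sum_spectrum kappa c c0 csum (fun k => sin (2 * pi * pairing k theta))) => // k.
  by rewrite ler_norml sin_geN1 sin_le1.
- move=> k kn0; rewrite /fourier_coef_norm.
  have D1 : 0 < (Delta (int_norm k)%:R)^-1 by rewrite invr_gt0 D0// ler1n int_norm_gt0.
  apply: bigmax_le => [|j _]; first exact: ltW.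
  rewrite fE (fourier_coef_trigsum kappa c)// /complex.ComplexField.Normc.normc.
  rewrite expr0n/= addr0 sqrtr_sqr.
  apply: (spectrum_le kappa c) => //; first exact: ltW.
  by move=> n kn; rewrite /c; case: kn => ->; rewrite ?int_normN.
Qed.

(** * Diophantine approximation *)

Lemma pigeonhole_dist {R : realType} {T : finType} (F : T -> R) (B : R) (n : nat) :
  (forall x, 0 <= F x < B) -> (0 < n)%N -> (n < #|T|)%N ->
  exists x y, x != y /\ `|F x - F y| < B / n%:R.
Proof.
move=> FB n0 nT.
have nr : 0 < n%:R :> R by rewrite ltr0n.
have B0 : 0 < B.
  have /card_gt0P[x _] : (0 < #|T|)%N by apply: leq_trans nT.
  by have /andP[] := FB x; exact: le_lt_trans.
pose G x := F x * (n%:R / B).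
have nB : 0 < n%:R / B by rewrite divr_gt0.
have G0 x : 0 <= G x by have /andP[F0 _] := FB x; rewrite mulr_ge0// ltW.
have Gn x : (Num.truncn (G x) < n)%N.
  rewrite -(ltr_nat R); have /andP[+ _] := truncn_itv (G0 x); move/le_lt_trans; apply.
  have /andP[_ FxB] := FB x.
  by rewrite /G mulrA ltr_pdivrMr// mulrC ltr_pM2l.
pose g x := Ordinal (Gn x).
have [[x [y [xy gxy]]]|H] := pselect (exists x y, x != y /\ g x = g y).
  exists x, y; split => //.
  have := truncn_itv (G0 x); have := truncn_itv (G0 y).
  have -> : Num.truncn (G y) = Num.truncn (G x) by have := congr1 val gxy; rewrite /= => ->.
  move=> /andP[y1 y2] /andP[x1 x2].
  have : `|G x - G y| < 1.
    by move: y1 y2 x1 x2; rewrite -natr1 ltr_norml => *; apply/andP; split; lra.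
  by rewrite /G -mulrBl normrM (gtr0_norm nB) -ltr_pdivlMr// div1r invf_div.
have ginj : injective g.
  by move=> x y gxy; apply/eqP/negPn/negP => xy; apply: H; exists x, y.
by have := leq_card g ginj; rewrite card_ord leqNgt nT.
Qed.

Lemma pairingBl {R : realType} d (k k' : 'rV[int]_d) (x : 'rV[R]_d) :
  pairing (k - k') x = pairing k x - pairing k' x.
Proof. by rewrite /pairing -sumrB; apply: eq_bigr => i _; rewrite !mxE intrB mulrBl. Qed.

Lemma pairingMn {R : realType} d (k : 'rV[int]_d) (q : nat) (x : 'rV[R]_d) :
  pairing (k *+ q) x = q%:R * pairing k x.
Proof.
rewrite /pairing mulr_sumr; apply: eq_bigr => i _.
by rewrite mulmxnE rmorphMn/= mulrnAl mulr_natl.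
Qed.

Lemma int_normMn d (k : 'rV[int]_d) (q : nat) : int_norm (k *+ q) = (q * int_norm k)%N.
Proof.
rewrite /int_norm (big_endo (muln q))//; last 2 first.
- by move=> x y; rewrite maxnMr.
- exact: muln0.
by apply: eq_bigr => i _; rewrite mulmxnE -mulr_natl natz abszM absz_nat.
Qed.

(* Pigeonhole on the [(K + 1) ^ d > K ^ s] integer points of the cube [[0, K]^d]. *)
Lemma dirichlet_pigeonhole {R : realType} d s K (rho : 'rV[R]_d) (B t : R)
    (Z : 'rV[int]_d -> int) : (s <= d)%N -> (0 < s)%N -> (0 < K)%N ->
  (forall k : 'rV[int]_d, (forall i, 0 <= k ord0 i <= K%:Z) ->
     0 <= pairing k rho - (Z k)%:~R + t < B) ->
  exists k k', [/\ k != k', (int_norm (k - k') <= K)%N &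
    `|pairing (k - k') rho - (Z k - Z k')%:~R| < B / K%:R ^+ s].
Proof.
move=> sd s0 K0 HB.
pose vec (p : {ffun 'I_d -> 'I_K.+1}) : 'rV[int]_d := \row_i (p i : nat)%:Z.
pose F p := pairing (vec p) rho - (Z (vec p))%:~R + t.
have FB p : 0 <= F p < B.
  by apply: HB => i; rewrite mxE; have := ltn_ord (p i); lia.
have cT : (K ^ s < #|{ffun 'I_d -> 'I_K.+1}|)%N.
  rewrite card_ffun !card_ord; apply: (@leq_trans (K.+1 ^ s)%N); last exact: leq_pexp2l.
  by rewrite ltn_exp2r.
have Ks : (0 < K ^ s)%N by rewrite expn_gt0 K0.
have [p [q [pq Fpq]]] := pigeonhole_dist F _ _ FB Ks cT.
exists (vec p), (vec q); split.
- apply: contra pq => /eqP e; apply/eqP/ffunP => i; apply/val_inj.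
  by have := congr1 (fun v : 'rV[int]_d => v ord0 i) e; rewrite !mxE => -[].
- apply/bigmax_leqP => i _; rewrite !mxE.
  have := ltn_ord (p i); have := ltn_ord (q i).
  by move: (nat_of_ord (p i)) (nat_of_ord (q i)) => a b; lia.
- move: Fpq; rewrite natrX; congr (`| _ | < _).
  by rewrite /F pairingBl intrB; ring.
Qed.

(* [b] selects the homogeneous problem (no integer translate), which costs one
   dimension because [<k, rho>] is no longer confined to an interval of length 1. *)
Lemma dirichlet {R : realType} d (b : bool) (rho : 'rV[R]_d) : (2 + b <= d)%N ->
  exists2 C : R, 0 < C & forall K, (0 < K)%N -> exists (k : 'rV[int]_d) (z : int),
    [/\ k != 0, (int_norm k <= K)%N, b -> z = 0 &
        `|pairing k rho - z%:~R| <= C / K%:R ^+ 2].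
Proof.
case: b => hd.
  pose S : R := \sum_i `|rho ord0 i|.
  have S0 : 0 <= S by apply: sumr_ge0.
  exists (2 * S + 1) => [|K K0]; first by rewrite ltr_wpDl// mulr_ge0.
  have Kr : 0 < K%:R :> R by rewrite ltr0n.
  (* The values fill an interval of length at most 2 K S, so K ^ 3 boxes give order K^-2. The [+ 1]
     makes the upper bound strict. *)
  have [|k [k' [kk' nk Hk]]] := @dirichlet_pigeonhole R d 3 K rho
    (K%:R * (2 * S + 1)) (K%:R * S) (fun=> 0) hd isT K0.
    move=> k kK.
    have : `|pairing k rho| <= K%:R * S.
      apply: le_trans (ler_norm_sum _ _ _) _; rewrite mulr_sumr; apply: ler_sum => i _.
      rewrite normrM ler_wpM2r//; have /andP[k0 k1] := kK i.
      by rewrite -intr_norm ger0_norm// pmulrn ler_int.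
    rewrite ler_norml subr0 => /andP[k1 k2]; apply/andP; split.
      by rewrite -lerBlDr sub0r.
    by apply: (@le_lt_trans _ _ (K%:R * S + K%:R * S)); [rewrite lerD2r|lra].
  exists (k - k'), 0; split => //; first by rewrite subr_eq0.
  move: Hk; rewrite subrr subr0 => /ltW /le_trans; apply.
  by rewrite le_eqVlt; apply/orP; left; apply/eqP; field; rewrite lt0r_neq0.
exists 1 => // K K0.
have [|k [k' [kk' nk Hk]]] := @dirichlet_pigeonhole R d 2 K rho 1 0
  (fun k => Num.floor (pairing k rho)) hd isT K0.
  move=> k _; rewrite addr0; have /andP[f1 f2] := floor_itv (pairing k rho).
  by rewrite subr_ge0 f1 ltrBlDl -[ltRHS]/(_%:~R + 1%:~R) -intrD.
exists (k - k'), (Num.floor (pairing k rho) - Num.floor (pairing k' rho)).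
by split => //; [rewrite subr_eq0|exact: ltW].
Qed.

(* Multiplying a Dirichlet approximation by [q] keeps it good, because the
   approximation order exceeds the size of the vector. *)
Lemma dirichlet_multiple {R : realType} d (b : bool) (rho : 'rV[R]_d) (q : nat) (delta : R) :
  (2 + b <= d)%N -> (0 < q)%N -> 0 < delta ->
  exists (k : 'rV[int]_d) (z : int),
    [/\ k != 0, b -> z = 0 &
        `|pairing (k *+ q) rho - z%:~R| * (int_norm (k *+ q))%:R <= delta].
Proof.
move=> hd q0 d0; have [C C0 H] := dirichlet _ _ rho hd.
(* One factor q scales the distance to the integer, the other the norm: the product is at most q ^ 2
   C / K. *)
pose K := (Num.bound (q%:R ^+ 2 * C / delta)).+1.
have Kr : 0 < K%:R :> R by rewrite ltr0n.
have [k [z [k0 nk bz Hk]]] := H K isT.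
exists k, (q%:Z * z); split => //; first by move=> /bz ->; rewrite mulr0.
rewrite pairingMn int_normMn intrM -pmulrn -mulrBr normrM normr_nat natrM.
have nkK : (int_norm k)%:R <= K%:R :> R by rewrite ler_nat.
apply: (@le_trans _ _ (q%:R * (C / K%:R ^+ 2) * (q%:R * K%:R))).
  by apply: ler_pM => //; rewrite ?mulr_ge0// ler_wpM2l.
have -> : q%:R * (C / K%:R ^+ 2) * (q%:R * K%:R) = q%:R ^+ 2 * C / K%:R.
  by field; rewrite lt0r_neq0.
rewrite ler_pdivrMr// [leRHS]mulrC -ler_pdivrMr//; apply: ltW.
apply: (lt_le_trans (archi_boundP _)); last by rewrite ler_nat.
by rewrite divr_ge0 ?(ltW d0)// mulr_ge0 ?exprn_ge0 ?(ltW C0).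
Qed.

(** Each pair (k, z) with k nonzero excludes a null hyperplane, and [unpickle] enumerates the
    countably many pairs. *)
Lemma ae_nonresonant {R : realType} d : ae_rV (fun rho : 'rV[R]_d =>
  forall k : 'rV[int]_d, k != 0 -> forall z : int, pairing k rho != z%:~R).
Proof.
pose N n := [set t : d.-tuple (measurableTypeR R) |
  if unpickle n is Some (k, z) then (k : 'rV[int]_d) != 0 /\
    linform (fun i => k ord0 i) t = (z : int)%:~R else False].
have nN n : (lebesgue_tuple R d).-negligible (N n).
  rewrite /N; case: (unpickle n) => [[k z]|];
    last by apply: (negligibleS _ (negligible_set0 _)) => t.
  have [k0|k0] := eqVneq k 0.
    apply: (negligibleS _ (negligible_set0 _)) => t /= []; by rewrite ?k0 ?eqxx.
  exists [set t | linform (fun i => k ord0 i) t = z%:~R]; split => [||t [] //].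
  - rewrite [X in measurable X](_ : _ = linform (fun i => k ord0 i) @^-1` [set z%:~R])//.
    by rewrite -[_ @^-1` _]setTI; apply: measurable_linform => //; exact: measurable_set1.
  - apply: lebesgue_tuple_linform0; apply: contrapT => H; move/eqP: k0; apply.
    apply/rowP => i; rewrite mxE; apply/eqP/negPn/negP => ki; apply: H; by exists i.
apply: (negligibleS _ (negligible_bigcup nN)) => t /= H.
apply: contrapT => H'; apply: H => k k0 z; apply/negP => /eqP e; apply: H'.
exists (pickle (k, z)) => //; rewrite /N /= pickleK; split => //.
by rewrite -e; apply: eq_bigr => i _; rewrite mxE.
Qed.

(** * Lacunary frequencies *)

Lemma sum_geometric_half {R : realType} n : \sum_(m < n) (2 ^- m : R) <= 2.
Proof.
suff -> : \sum_(m < n) (2 ^- m : R) = 2 - 2 * 2 ^- n.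
  by rewrite lerBlDr lerDl mulr_ge0.
elim: n => [|n IH]; first by rewrite big_ord0 expr0 invr1 mulr1 subrr.
by rewrite big_ord_recr/= IH exprS; field.
Qed.

Section lacunary_series.
Context {R : realType}.
Variable a : R^nat.
Hypotheses (a_gt0 : forall n, 0 < a n) (a_lac : forall n, 16 * a n.+1 <= a n).

(** The partial sum plus an eighth of its last term does not increase: 9/8 of the new term is at
    most 9/128 of the previous one, less than an eighth of it. *)
Let series_tail n j : series a (n.+1 + j)%N + a (n + j)%N / 8 <= series a n.+1 + a n / 8.
Proof.
elim: j => [|j IH]; first by rewrite !addn0.
apply: le_trans IH; rewrite addnS {1}/series/= big_nat_recr//=.
rewrite -[X in X + _ + _]/(series a (n.+1 + j)%N) addSn -addnS -addrA lerD2l.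
by have := a_lac (n + j)%N; have := a_gt0 (n + j)%N; rewrite addnS; lra.
Qed.

Let series_homo : {homo series a : m n / (m <= n)%N >-> m <= n}.
Proof.
by apply/nondecreasing_seqP => n; rewrite /series/= big_nat_recr//= lerDl ltW.
Qed.

Let series_ub n m : series a m <= series a n.+1 + a n / 8.
Proof.
apply: (@le_trans _ _ (series a (n.+1 + m)%N)); first by apply: series_homo; rewrite leq_addl.
by apply: le_trans (series_tail n m); rewrite lerDl divr_ge0// ltW.
Qed.

Lemma lacunary_cvg : cvgn (series a).
Proof.
apply: nondecreasing_is_cvgn => //.
by exists (series a 1 + a 0%N / 8) => _ [m _ <-]; exact: series_ub.
Qed.

Lemma lacunary_tail n : limn (series a) - series a n.+1 <= a n / 8.
Proof.
rewrite lerBlDl; apply: limr_le; first exact: lacunary_cvg.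
by apply: nearW => m; exact: series_ub.
Qed.

(** The n-th term is at least a_n / 2. The tail is at most a_n / 8 by lacunarity, and so is the
    head, because the factors [2 ^- m] sum to at most 2. *)
Lemma lacunary_lower_bound (w : R^nat) n : (forall m, `|w m| <= 1) -> 1 / 2 <= w n ->
  (forall m, (m < n)%N -> a m * `|w m| <= 2 ^- m * a n / 16) ->
  a n / 8 <= `|limn (series (fun m => a m * w m))|.
Proof.
move=> w1 wn small; set u := fun m => a m * w m.
have ua m : `|u m| <= a m.
  by rewrite normrM (gtr0_norm (a_gt0 m)) -[leRHS]mulr1 ler_wpM2l// ltW.
have tail : `|limn (series u) - series u n.+1| <= a n / 8.
  exact: le_trans (dominated_series_tail _ _ _ lacunary_cvg ua) (lacunary_tail n).
have head : `|series u n| <= a n / 8.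
  rewrite /series/= big_mkord; apply: le_trans (ler_norm_sum _ _ _) _.
  apply: (@le_trans _ _ (\sum_(m < n) (2 ^- m * a n / 16))).
    by apply: ler_sum => m _; rewrite normrM (gtr0_norm (a_gt0 m)) small.
  rewrite -mulr_suml -mulr_suml -mulrA.
  have := @sum_geometric_half R n; have := a_gt0 n; nra.
have mid : series u n.+1 = series u n + u n by rewrite /series/= big_nat_recr.
have un : a n / 2 <= u n by have := a_gt0 n; rewrite /u; nra.
have := ler_norm (limn (series u)).
move: tail head; rewrite !ler_norml mid => /andP[t1 t2] /andP[h1 h2].
have := a_gt0 n; lra.
Qed.

End lacunary_series.

Section lacunary_frequencies.
Context {R : realType} {d : nat}.
Variables (Delta : R -> R) (b : bool) (rho : 'rV[R]_d).
Hypotheses (Delta_gt0 : forall x, 1 <= x -> 0 < Delta x)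
  (Delta_oo : Delta x @[x --> +oo] --> +oo)
  (hd : (2 + b <= d)%N).
(* [W k N phi] stands for the average up to time [N] of the mode [k] with
   initial phase [phi]. *)
Variable W : 'rV[int]_d -> nat -> R -> R.
Hypothesis W_decay : forall k, k != 0 -> forall eps, 0 < eps -> exists N0 : nat,
  forall N phi, (N0 <= N)%N -> `|W k N phi| <= eps / Delta N%:R.

(** A recursion with two choice functions: [G] returns a vector above a prescribed size with the
    arithmetic properties of its stage, and [thr] the size beyond which a mode already chosen is
    negligible. *)
Lemma lacunary_frequencies (N1 : nat) (delta : R) : 0 < delta ->
  exists kappa : nat -> 'rV[int]_d,
  [/\ forall n, kappa n != 0 /\ (N1 <= int_norm (kappa n))%N,
      forall n, (int_norm (kappa n) < int_norm (kappa n.+1))%N /\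
        16 * Delta (int_norm (kappa n))%:R <= Delta (int_norm (kappa n.+1))%:R,
      forall n, exists k', kappa n = k' *+ (n.+1)`!,
      forall n, exists z : int, (b -> z = 0) /\
        `|pairing (kappa n) rho - z%:~R| * (int_norm (kappa n))%:R <= delta
    & forall m n phi, (m < n)%N -> `|W (kappa m) (int_norm (kappa n)) phi| <=
        2 ^- m * Delta (int_norm (kappa m))%:R / 16 / Delta (int_norm (kappa n))%:R].
Proof.
move=> delta0.
have D0 (k : 'rV[int]_d) : k != 0 -> 0 < Delta (int_norm k)%:R.
  by move=> k0; rewrite Delta_gt0// ler1n int_norm_gt0.
have stepG (nx : nat * nat) : exists k : 'rV[int]_d,
    [/\ k != 0, (nx.2 <= int_norm k)%N, exists k', k = k' *+ (nx.1.+1)`! &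
      exists z : int, (b -> z = 0) /\ `|pairing k rho - z%:~R| * (int_norm k)%:R <= delta].
  (* The factor [x.+1] forces the norm above x, whatever nonzero vector Dirichlet's theorem
     returns. *)
  case: nx => n x /=; pose q := (x.+1 * (n.+1)`!)%N.
  have q0 : (0 < q)%N by rewrite muln_gt0 fact_gt0.
  have [k [z [k0 bz Hk]]] := dirichlet_multiple _ _ rho q delta hd q0 delta0.
  have kn : (0 < int_norm (k *+ q))%N by rewrite int_normMn muln_gt0 q0 int_norm_gt0.
  exists (k *+ q); split.
  - by apply: contraTneq kn => ->; rewrite -leqNgt; apply/bigmax_leqP => i _; rewrite mxE.
  - rewrite int_normMn -mulnA (leq_trans (leqnSn x))// leq_pmulr//.
    by rewrite muln_gt0 fact_gt0 int_norm_gt0.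
  - by exists (k *+ x.+1); rewrite /q mulrnA.
  - by exists z.
have [G HG] := choice stepG.
have stepT (nk : nat * 'rV[int]_d) : exists N0 : nat, nk.2 != 0 -> forall N, (N0 <= N)%N ->
    [/\ (int_norm nk.2 < N)%N, 16 * Delta (int_norm nk.2)%:R <= Delta N%:R &
    forall phi, `|W nk.2 N phi| <= 2 ^- nk.1 * Delta (int_norm nk.2)%:R / 16 / Delta N%:R].
  case: nk => n k /=; have [->|k0] := eqVneq k 0; first by exists 0%N.
  have e0 : 0 < 2 ^- n * Delta (int_norm k)%:R / 16.
    by rewrite divr_gt0// mulr_gt0 ?D0// invr_gt0 exprn_gt0.
  have [N0 HN0] := W_decay k k0 _ e0.
  move/cvgryPge : Delta_oo => /(_ (16 * Delta (int_norm k)%:R)) [A [_ HA]].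
  exists (maxn N0 (maxn (int_norm k).+1 (Num.bound `|A|))) => _ N.
  rewrite !geq_max => /andP[NN0 /andP[Nk NA]]; split => //; last by move=> phi; exact: HN0.
  apply: HA; apply: le_lt_trans (ler_norm A) _.
  by apply: (lt_le_trans (archi_boundP _)) => //; rewrite ler_nat.
have [thr Hthr] := choice stepT.
pose kappa := fix kappa n := match n with
  | 0 => G (0, N1)
  | n'.+1 => G (n'.+1, maxn N1 (thr (n', kappa n')))
  end.
have k0 n : kappa n != 0.
  by case: n => [|n] /=; [have [] := HG (0, N1)|have [] := HG (n.+1, maxn N1 (thr (n, kappa n)))].
have kN1 n : (N1 <= int_norm (kappa n))%N.
  case: n => [|n] /=; first by have [] := HG (0, N1).
  have [_ /= + _ _] := HG (n.+1, maxn N1 (thr (n, kappa n))).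
  by apply: leq_trans; exact: leq_maxl.
have kthr n : (thr (n, kappa n) <= int_norm (kappa n.+1))%N.
  have [_ /= + _ _] := HG (n.+1, maxn N1 (thr (n, kappa n))).
  by apply: leq_trans; exact: leq_maxr.
have kinc n : (int_norm (kappa n) < int_norm (kappa n.+1))%N.
  by have [] := Hthr (n, kappa n) (k0 n) _ (kthr n).
have kmono m n : (m <= n)%N -> (int_norm (kappa m) <= int_norm (kappa n))%N.
  elim: n => [|n IH]; first by rewrite leqn0 => /eqP ->.
  by rewrite leq_eqVlt => /predU1P[->//|/IH mn]; rewrite (leq_trans mn)// ltnW.
exists kappa; split.
- by [].
- by move=> n; split=> //; have [] := Hthr (n, kappa n) (k0 n) _ (kthr n).
- by case=> [|n] /=; [have [] := HG (0, N1)|have [] := HG (n.+1, maxn N1 (thr (n, kappa n)))].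
- by case=> [|n] /=; [have [] := HG (0, N1)|have [] := HG (n.+1, maxn N1 (thr (n, kappa n)))].
(* The threshold of [kappa m] is passed at stage m + 1 and stays passed, as the norms increase. *)
- move=> m n phi mn; have tn := leq_trans (kthr m) (kmono _ _ mn).
  by have [_ _ /= H] := Hthr (m, kappa m) (k0 m) _ tn; exact: H.
Qed.

End lacunary_frequencies.

(** * Lower bound for the errors *)

Definition rational_point {R : realType} {d} (theta : 'rV[R]_d) : Prop :=
  exists2 q : nat, (0 < q)%N & forall i, exists z : int, q%:R * theta ord0 i = z%:~R.

(** Once n reaches the common denominator q of the coordinates, q divides the factorial. *)
Lemma pairing_rational_point {R : realType} d (theta : 'rV[R]_d) : rational_point theta ->
  exists n0 : nat, forall n (k : 'rV[int]_d), (n0 <= n)%N ->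
    exists z : int, pairing (k *+ n.+1`!) theta = z%:~R.
Proof.
move=> [q q0 /choice[z hz]]; exists q => n k qn.
have /dvdnP[m ->] : (q %| n.+1`!)%N by rewrite dvdn_fact// q0 ltnW.
exists (m%:Z * \sum_i k ord0 i * z i).
rewrite pairingMn natrM -mulrA intrM -pmulrn; congr (_ * _).
rewrite /pairing mulr_sumr rmorph_sum/=; apply: eq_bigr => i _.
by rewrite intrM -hz mulrCA.
Qed.

Section construction.
Context {R : realType} {d : nat}.
Variables (Delta : R -> R) (b : bool) (rho : 'rV[R]_d).
Hypotheses (Delta_gt0 : forall x, 1 <= x -> 0 < Delta x)
  (Delta_oo : Delta x @[x --> +oo] --> +oo)
  (hd : (2 + b <= d)%N).
Variables (W : 'rV[int]_d -> nat -> R -> R) (N1 : nat) (delta : R).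
Hypotheses (delta_gt0 : 0 < delta)
  (W_decay : forall k, k != 0 -> forall eps, 0 < eps -> exists N0 : nat,
     forall N phi, (N0 <= N)%N -> `|W k N phi| <= eps / Delta N%:R)
  (W_le1 : forall k N phi, (0 < N)%N -> `|W k N phi| <= 1)
  (W_ge : forall k N (z z' : int), (N1 <= N)%N -> (0 < N)%N -> (b -> z = 0) ->
     `|pairing k rho - z%:~R| * N%:R <= delta -> 1 / 2 <= W k N (2 * pi * z'%:~R)).

(** An abstract average [W], with [b] telling whether the integer must be 0, lets rotation and flow
    share one proof. The frequencies are chosen before [theta]; only [n0] depends on it. *)
Lemma lacunary_construction : exists kappa : nat -> 'rV[int]_d,
  [/\ forall n, kappa n != 0,
      forall m n, kappa m = kappa n \/ kappa m = - kappa n -> m = n,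
      forall n, (n < int_norm (kappa n))%N,
      cvgn (series (fun n => 2 * (Delta (int_norm (kappa n))%:R)^-1))
    & forall theta, rational_point theta -> exists n0 : nat, forall n, (n0 <= n)%N ->
        1 / (4 * Delta (int_norm (kappa n))%:R) <=
        `|limn (series (fun m => 2 * (Delta (int_norm (kappa m))%:R)^-1 *
            W (kappa m) (int_norm (kappa n)) (2 * pi * pairing (kappa m) theta)))|].
Proof.
have [kappa [k0N1 kinc kfact kz ksmall]] :=
  lacunary_frequencies _ _ rho Delta_gt0 Delta_oo hd W W_decay N1 delta delta_gt0.
have k0 n : kappa n != 0 by have [] := k0N1 n.
have kpos n : (0 < int_norm (kappa n))%N by exact: int_norm_gt0.
have D0 n : 0 < Delta (int_norm (kappa n))%:R by rewrite Delta_gt0// ler1n.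
pose a n := 2 * (Delta (int_norm (kappa n))%:R)^-1.
have a0 n : 0 < a n by rewrite mulr_gt0// invr_gt0.
have alac n : 16 * a n.+1 <= a n.
  have [_ H] := kinc n.
  rewrite /a mulrCA; apply: ler_wpM2l => //.
  by rewrite ler_pdivrMr// ler_pdivlMl// mulrC.
have kmono m n : (m < n)%N -> (int_norm (kappa m) < int_norm (kappa n))%N.
  elim: n => // n IH; have [kn _] := kinc n.
  by rewrite ltnS leq_eqVlt => /predU1P[->//|/IH mn]; exact: ltn_trans kn.
exists kappa; split => //.
- move=> m n kmn; have e : int_norm (kappa m) = int_norm (kappa n).
    by case: kmn => ->; rewrite ?int_normN.
  by case: (ltngtP m n) => // /kmono; rewrite e ltnn.
- by elim=> [|n IH]; [exact: kpos|have [kn _] := kinc n; exact: leq_ltn_trans kn].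
- exact: (lacunary_cvg _ a0 alac).
- move=> theta /pairing_rational_point[n0 Hn0]; exists n0 => n n0n.
  have [k' kE] := kfact n; have [z' Hz'] := Hn0 n k' n0n.
  have [z [bz Hz]] := kz n.
  pose wm m := W (kappa m) (int_norm (kappa n)) (2 * pi * pairing (kappa m) theta).
  have w1 m : `|wm m| <= 1 by exact: W_le1.
  have wn : 1 / 2 <= wm n.
    have e : pairing (kappa n) theta = z'%:~R by rewrite kE.
    by rewrite /wm e; apply: W_ge bz Hz => //; have [] := k0N1 n.
  have sm m : (m < n)%N -> a m * `|wm m| <= 2 ^- m * a n / 16.
    move=> mn; apply: le_trans (ler_wpM2l (ltW (a0 m)) (ksmall m n _ mn)) _.
    rewrite /a le_eqVlt; apply/orP; left; apply/eqP; field.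
    by rewrite !lt0r_neq0.
  (* Since a_n = 2 / Delta, the bound a_n / 8 is the required 1 / (4 Delta). *)
  apply: le_trans (lacunary_lower_bound _ a0 alac wm n w1 wn sm).
  rewrite /a mul1r invfM le_eqVlt; apply/orP; left; apply/eqP; field.
  by rewrite lt0r_neq0.
Qed.

End construction.

Lemma ler_norm_row_entry {R : realType} l (v : 'rV[R]_l) (j : 'I_l) : `|v ord0 j| <= `|v|.
Proof.
rewrite [leRHS]/Num.norm/= mx_normrE.
exact: (le_bigmax _ (fun ij : 'I_1 * 'I_l => `|v ij.1 ij.2|) (ord0, j)).
Qed.

Section errors.
Context {R : realType} {d l : nat}.
Variables (beta : R) (w : R -> R) (kappa : nat -> 'rV[int]_d) (c : R^nat).
Hypotheses (hw : weighting_class beta w) (k0 : forall n, kappa n != 0)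
  (kinj : forall m n, kappa m = kappa n \/ kappa m = - kappa n -> m = n)
  (c_ge0 : forall n, 0 <= c n) (c2sum : cvgn (series (fun n => 2 * c n))) (hl : (0 < l)%N).

Let f (x : 'rV[R]_d) : 'rV[R]_l := \row_(j < l) trigsum kappa (fun n => 2 * c n) 0 x.

Let csum : cvgn (series c).
Proof.
apply: (dominated_series_cvg _ _ c2sum) => n; rewrite ger0_norm//.
by rewrite mulr_natl mulr2n lerDl.
Qed.

Let mean0 j : torus_mean f ord0 j = 0.
Proof.
rewrite mxE -(torus_integral_trigsum kappa c k0 c_ge0 csum); congr torus_integral.
by apply/funext => x; rewrite mxE.
Qed.

Let u_cvg (x : 'rV[R]_d) :
  cvgn (series (fun m => 2 * c m * cos (2 * pi * pairing (kappa m) x + 0))).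
Proof.
apply: (dominated_series_cvg _ _ c2sum) => m; rewrite normrM ger0_norm ?mulr_ge0//.
by rewrite -[leRHS]mulr1 ler_wpM2l ?mulr_ge0// ler_norml cos_geN1 cos_le1.
Qed.

Let phase (rho theta : 'rV[R]_d) (s : R) m :
  2 * pi * pairing (kappa m) (rotation rho s theta) + 0 =
  2 * pi * pairing (kappa m) theta + 2 * pi * (pairing (kappa m) rho * s).
Proof. by rewrite /rotation pairingDr pairingZr; ring. Qed.

(** One component bounds the maximum norm from below, the observable has mean 0, and the finite
    average is exchanged with the series. *)
Lemma error_dis_ge (rho theta : 'rV[R]_d) (N : nat) :
  `|limn (series (fun m => 2 * c m *
     avg_dis w N (pairing (kappa m) rho) (2 * pi * pairing (kappa m) theta)))|
  <= error_dis w f rho theta N.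
Proof.
apply: le_trans (ler_norm_row_entry _ _ (Ordinal hl)).
rewrite mxE [X in _ + X]mxE mean0 subr0 mxE summxE.
under eq_bigr do rewrite !mxE /trigsum mul_lim_series//.
rewrite sum_lim_series => [|n]; last exact: (@is_cvg_seriesZ R _ (w (n%:R / N%:R)) (u_cvg _)).
rewrite mul_lim_series; last first.
  apply: (dominated_series_cvg _ _ (@is_cvg_seriesZ R _ (\sum_(n < N) w (n%:R / N%:R)) c2sum)) => m.
  rewrite [leRHS](_ : _ = (\sum_(n < N) w (n%:R / N%:R)) * (2 * c m))// mulr_suml.
  apply: le_trans (ler_norm_sum _ _ _) _; apply: ler_sum => n _.
  have [[w0 _ _ _] _ _] := hw.
  rewrite !normrM (ger0_norm (w0 _)) normr_nat (ger0_norm (c_ge0 _)) ler_wpM2l//.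
  by rewrite -[leRHS]mulr1 ler_wpM2l ?mulr_ge0// ler_norml cos_geN1 cos_le1.
rewrite le_eqVlt; apply/orP; left; apply/eqP; congr (`|limn (series _)|); apply/funext => m.
rewrite /avg_dis mulrCA; congr (_ * _); rewrite mulr_sumr.
by apply: eq_bigr => n _; rewrite phase mulrCA.
Qed.

(** Here the series is exchanged with an integral, which the boundedness of w and the finite length
    of [0, T] justify. *)
Lemma error_con_ge (rho theta : 'rV[R]_d) (T : R) : 0 < T ->
  `|limn (series (fun m => 2 * c m *
     avg_con w T (pairing (kappa m) rho) (2 * pi * pairing (kappa m) theta)))|
  <= error_con w f rho theta T.
Proof.
move=> T0; apply: le_trans (ler_norm_row_entry _ _ (Ordinal hl)).
rewrite mxE [X in _ + X]mxE mean0 subr0 !mxE.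
have [B B0 wB] : exists2 B, 0 <= B & forall x, `|w x| <= B.
  have [C [lambda [C0 l0 HB]]] := weight_derive_bound _ _ hw.
  exists (C * lambda ^+ 1 * (1%:R `^ (1%:R * beta))); last exact: (HB 0%N).
  by rewrite !mulr_ge0 ?powR_ge0 ?exprn_ge0 ?(ltW C0) ?(ltW l0).
pose g m s := 2 * c m * (w (s / T) *
  cos (2 * pi * pairing (kappa m) theta + 2 * pi * (pairing (kappa m) rho * s))).
have cg m : continuous (fun s : R => w (s / T) *
    cos (2 * pi * pairing (kappa m) theta + 2 * pi * (pairing (kappa m) rho * s))).
  exact: (cont_weight_cos _ _ hw).
have BT : cvgn (series (fun m => B * (2 * c m))) by exact: (@is_cvg_seriesZ R _ B c2sum).
have gB m s : `|g m s| <= B * (2 * c m).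
  rewrite /g mulrC normrM (ger0_norm (_ : 0 <= 2 * c m)) ?mulr_ge0// ler_wpM2r ?mulr_ge0//.
  rewrite normrM -[leRHS]mulr1; apply: ler_pM => //.
  by rewrite ler_norml cos_geN1 cos_le1.
have -> : \int[lebesgue_measure]_(s in `[0, T])
      (w (s / T) * f (rotation rho s theta) ord0 (Ordinal hl)) =
    limn (series (fun m => \int[lebesgue_measure]_(s in `[0, T]) g m s)).
  rewrite -(Rintegral_series _ _ _ _ _ _ BT)//; last 2 first.
  - by rewrite /= lebesgue_measure_itv/= lte_fin T0 -EFinD ltry.
  - move=> m; apply: measurable_funTS; apply: measurable_funM; first exact: measurable_cst.
    exact: continuous_measurable_fun.
  apply: eq_Rintegral => s _; rewrite mxE /trigsum mul_lim_series//.
  congr (limn (series _)); apply/funext => m.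
  by rewrite phase /g mulrCA.
have I_le m : `|\int[lebesgue_measure]_(s in `[0, T]) g m s| <= T * (B * (2 * c m)).
  have ig : (@lebesgue_measure R).-integrable `[0, T] (EFin \o g m).
    apply: continuous_integrable_itv => s.
    by apply: cvgM; [exact: cvg_cst|exact: cg].
  apply: le_trans (le_normr_Rintegral _ ig) _ => //.
  apply: (@le_trans _ _ (\int[@lebesgue_measure R]_(s in `[0, T]) (B * (2 * c m)))).
    apply: le_Rintegral => //.
    - exact: (integrable_norm ig).
    - by apply: continuous_integrable_itv => s; exact: cst_continuous.
  by rewrite Rintegral_cst//= lebesgue_measure_itv/= lte_fin T0 -EFinD/= subr0 mulrC.
rewrite mul_lim_series; last first.
  by apply: (dominated_series_cvg _ _ (@is_cvg_seriesZ R _ T BT)) => m; exact: I_le.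
rewrite le_eqVlt; apply/orP; left; apply/eqP; congr (`|limn (series _)|); apply/funext => m.
rewrite /avg_con mulrCA; congr (_ * _); rewrite /g RintegralZl//.
exact: continuous_integrable_itv.
Qed.

End errors.

(** These are the rational numbers, with denominators cleared as in [rational_point]. *)
Definition rational_multiple {R : realType} (t : R) : Prop :=
  exists2 q : nat, (0 < q)%N & exists z : int, q%:R * t = z%:~R.

Lemma rational_multiple_periodic {R : realType} (t : R) (m : int) :
  rational_multiple (t + m%:~R) <-> rational_multiple t.
Proof.
suff H (s : R) (n : int) : rational_multiple s -> rational_multiple (s + n%:~R).
  by split; last exact: H; move/H => /(_ (- m)); rewrite mulrNz addrK.
move=> [q q0 [z hz]]; exists q => //; exists (z + q%:Z * n).
by rewrite mulrDr hz intrD intrM -pmulrn.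
Qed.

Lemma dense_rational_multiple {R : realType} : dense [set t : R | rational_multiple t].
Proof.
move=> O O0 oO; have [t [Ot [r _ rt]]] := @dense_rat R O O0 oO.
exists t; split => //; exists `|denq r|%N; first by rewrite absz_gt0 denq_neq0.
exists (numq r); rewrite -rt /ratr mulrC pmulrn gez0_abs ?denq_ge0// divfK//.
by rewrite intr_eq0 denq_neq0.
Qed.

(** The indices may coincide; with [t2] = 0 this covers points with a single nonzero coordinate. *)
Lemma rational_point_delta {R : realType} d (i1 i2 : 'I_d) (t1 t2 : R) :
  rational_multiple t1 -> rational_multiple t2 ->
  rational_point (t1 *: delta_mx ord0 i1 + t2 *: delta_mx ord0 i2).
Proof.
move=> [q1 q10 [z1 hz1]] [q2 q20 [z2 hz2]]; exists (q1 * q2)%N => [|i].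
  by rewrite muln_gt0 q10.
exists (q2%:Z * z1 * (i == i1) + q1%:Z * z2 * (i == i2)).
by rewrite !mxE eqxx/= intrD !intrM -hz1 -hz2 -!pmulrn natrM; ring.
Qed.

Lemma ae_rV_sub {R : realType} d (P Q : 'rV[R]_d -> Prop) :
  ae_rV P -> (forall rho, P rho -> Q rho) -> ae_rV Q.
Proof. by move=> aeP PQ; apply: filterS aeP => t; exact: PQ. Qed.

(** Summability is a clause of [observable_space], which is empty without it; hence it is a
    hypothesis for each [d]. *)
Theorem corollary3p1 (R : realType) (beta : R) (w Delta : R -> R) (l : nat)
    (hbeta : 1 <= beta) (hw : weighting_class beta w)
    (hDelta : approximation_function Delta)
    (hbounds : exists eps zeta : R,
       [/\ 0 < eps, 0 < zeta, zeta < beta^-1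
         & forall x, 1 <= x ->
             x `^ eps <= Delta x /\ Delta x <= expR (x `^ zeta)])
    (hl : (1 <= l)%N) :
  (forall d : nat, (2 <= d)%N -> weight_summable Delta d 0 ->
     ae_rV (fun rho : 'rV[R]_d =>
       exists (Psi : 'rV[R]_d -> 'rV[R]_l) (Xi : set R) (i : 'I_d),
         [/\ observable_space Delta Psi,
             torus_set1 Xi, dense Xi, Xi 0
           & forall t : R, Xi t ->
               forall M : nat, exists N : nat,
                 [/\ (M <= N)%N, (0 < N)%N
                   & 1 / (4 * Delta N%:R) <=
                     error_dis w Psi rho (t *: delta_mx ord0 i) N]]))
  /\
  (forall d : nat, (3 <= d)%N -> weight_summable Delta d 0 ->
     ae_rV (fun rho : 'rV[R]_d =>
       exists (Phi : 'rV[R]_d -> 'rV[R]_l) (Theta : set (R * R))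
              (i1 i2 : 'I_d),
         [/\ observable_space Delta Phi,
             torus_set2 Theta, Theta (0, 0), (i1 < i2)%N
           & forall t1 t2 : R, Theta (t1, t2) ->
               exists T : nat -> R,
                 [/\ T n @[n --> \oo] --> +oo,
                     forall n, 1 <= T n
                   & forall n,
                     1 / (4 * Delta (T n)) <=
                     error_con w Phi rho
                       (t1 *: delta_mx ord0 i1 + t2 *: delta_mx ord0 i2)
                       (T n)]])).
Proof.
have [_ Delta_inc Delta1 Delta_oo] := hDelta.
have [eps0 [zeta [_ z0 zb Delta_bd]]] := hbounds.
have Delta_le x : 1 <= x -> Delta x <= expR (x `^ zeta) by case/Delta_bd.
have Delta_gt0 x : 1 <= x -> 0 < Delta x.
  rewrite le_eqVlt => /predU1P[<-//|x1]; apply: lt_trans Delta1 _.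
  by apply: Delta_inc => //; rewrite in_itv/= ?lexx// ltW.
have [e e0 He] := @cos_ge_half R.
(* Division by 2 pi turns the admissible phase of [cos_ge_half] into a distance to the integers. *)
have delta0 : 0 < e / (2 * pi) by rewrite divr_gt0// mulr_gt0// pi_gt0.
have delta_le (x : R) : x <= e / (2 * pi) -> 2 * pi * x <= e.
  by rewrite ler_pdivlMr ?mulr_gt0 ?pi_gt0// mulrC.
have rat0 : rational_multiple (0 : R) by exists 1%N => //; exists 0; rewrite mulr0.
split=> d hd hsum; apply: (ae_rV_sub _ _ _ (@ae_nonresonant R d)) => rho nonres.
- have [N1 HN1] := avg_dis_ge _ _ hw e He.
  have [kappa [k0 kinj klarge ksum kbound]] := @lacunary_construction R d Delta false rho
    Delta_gt0 Delta_oo hd (fun k N phi => avg_dis w N (pairing k rho) phi) N1 _ delta0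
    (fun k k0 eps => avg_dis_decay _ _ _ hw Delta_gt0 _ hbeta z0 zb Delta_le _ eps (nonres k k0))
    (fun k N phi _ => avg_dis_le1 _ _ hw N _ phi)
    (fun k N z z' NN1 _ _ Hz => HN1 N _ z z' NN1 (delta_le _ Hz)).
  (* The bound holds at all rational points, so any coordinate would do; the first is taken. *)
  exists (fun x => \row_(j < l) trigsum kappa
      (fun n => 2 * (Delta (int_norm (kappa n))%:R)^-1) 0 x),
    [set s | rational_multiple s], (Ordinal (ltnW hd)).
  split => //.
  + exact: observable_trigsum.
  + by move=> s m; exact: rational_multiple_periodic.
  + exact: dense_rational_multiple.
  + move=> s hs M.
    have rp := rational_point_delta _ (Ordinal (ltnW hd)) (Ordinal (ltnW hd)) _ _ hs rat0.
    rewrite scale0r addr0 in rp; have [n0 Hn0] := kbound _ rp.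
    exists (int_norm (kappa (maxn n0 M))); split.
    * by apply: leq_trans (ltnW (klarge _)); exact: leq_maxr.
    * by rewrite int_norm_gt0.
    * apply: le_trans (Hn0 _ (leq_maxl _ _)) _.
      apply: (error_dis_ge _ _ _ _ hw k0) => // n.
      by rewrite invr_ge0 ltW// Delta_gt0// ler1n int_norm_gt0.
- have nonres0 k : k != 0 -> pairing k rho != 0 by move=> k0; exact: (nonres k k0 0).
  have Np N : (0 < N)%N -> 0 < N%:R :> R by rewrite ltr0n.
  (* For the flow the lower bound holds at every positive time, hence the threshold 0. *)
  have W_ge k N (z z' : int) : (0 <= N)%N -> (0 < N)%N -> (true -> z = 0) ->
     `|pairing k rho - z%:~R| * N%:R <= e / (2 * pi) ->
     1 / 2 <= avg_con w N%:R (pairing k rho) (2 * pi * z'%:~R).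
    move=> _ N0 z0' /delta_le; rewrite (z0' isT) subr0.
    exact: (avg_con_ge _ _ hw e _ _ _ He (Np _ N0)).
  have [kappa [k0 kinj klarge ksum kbound]] := @lacunary_construction R d Delta true rho
    Delta_gt0 Delta_oo hd (fun k N phi => avg_con w N%:R (pairing k rho) phi) 0 _ delta0
    (fun k k0 eps => avg_con_decay _ _ _ hw Delta_gt0 _ hbeta z0 zb Delta_le _ eps (nonres0 k k0))
    (fun k N phi N0 => avg_con_le1 _ _ hw _ _ phi (Np _ N0)) W_ge.
  exists (fun x => \row_(j < l) trigsum kappa
      (fun n => 2 * (Delta (int_norm (kappa n))%:R)^-1) 0 x),
    [set s | rational_multiple s.1 /\ rational_multiple s.2],
    (Ordinal (ltnW (ltnW hd))), (Ordinal (ltnW hd)).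
  split => //.
  + exact: observable_trigsum.
  + move=> x y m n; have H := @rational_multiple_periodic R.
    split=> -[/= H1 H2]; split;
      [exact: (H _ m).1|exact: (H _ n).1|exact: (H _ m).2|exact: (H _ n).2].
  + move=> t1 t2 [/= h1 h2].
    have [n0 Hn0] := kbound _
      (rational_point_delta _ (Ordinal (ltnW (ltnW hd))) (Ordinal (ltnW hd)) _ _ h1 h2).
    exists (fun n => (int_norm (kappa (n0 + n)%N))%:R); split.
    * apply/cvgryPge => A; near=> n.
      have An : A <= n%:R by near: n; exact: nbhs_infty_ger.
      apply: le_trans An _; rewrite ler_nat.
      by apply: leq_trans (ltnW (klarge _)); exact: leq_addl.
    * by move=> n; rewrite ler1n int_norm_gt0.
    * move=> n; apply: le_trans (Hn0 _ (leq_addr _ _)) _.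
      apply: (error_con_ge _ _ _ _ hw k0) => // [m|]; last by rewrite ltr0n int_norm_gt0.
      by rewrite invr_ge0 ltW// Delta_gt0// ler1n int_norm_gt0.
Unshelve. all: by end_near. Qed.
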